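(* Consider observations $y_j=S_\vartheta(x_j)+\sigma_j(\vartheta)\xi_j$, $1\le j\le n$, $x_j=j/n$, where $\xi_1,\dots,\xi_n$ are i.i.d. $\mathcal N(0,1)$, $\vartheta=(\vartheta_1,\dots,\vartheta_l)'\in\mathbb R^l$ is a parameter, $S_\vartheta\in C[0,1]$, and $\sigma_j(\vartheta)=g(x_j,S_\vartheta)$ with $g$ satisfying conditions $\mathbf H_1$ and $\mathbf H_2$ (stated in the context). Let $\vartheta$ have prior density $\Phi(\vartheta)=\prod_{i=1}^l\varphi_i(\vartheta_i)$, where each $\varphi_i$ is a continuously differentiable bounded probability density on $\mathbb R$ with $\mathcal I_i=\int_{\mathbb R}(\dot\varphi_i(z))^2/\varphi_i(z)\,dz<\infty$. Let $\lambda:\mathbb R^l\to\mathbb R$ be continuously differentiable with, for every $1\le i\le l$, $\lim_{|\vartheta_i|\to\infty}\lambda(\vartheta)\varphi_i(\vartheta_i)=0$ and $\int_{\mathbb R^l}|\lambda_i'(\vartheta)|\Phi(\vartheta)d\vartheta<\infty$, where $\lambda_i'=\partial\lambda/\partial\vartheta_i$. Assume that for every $1\le i\le l$ there is $S'_{\vartheta,i}\in C[0,1]$ with $$\lim_{h\to0}\max_{0\le x\le1}\big|(S_{\vartheta+h\mathbf e_i}(x)-S_\vartheta(x)-S'_{\vartheta,i}(x)h)/h\big|=0,$$ $\mathbf e_i$ being the $i$th unit vector. Then for every square integrable estimator $\hat\lambda_n$ of $\lambda(\vartheta)$ based on $(y_1,\dots,y_n)$ and every $1\le i\le l$, $$\tilde{\mathbf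 E}(\hat\lambda_n-\lambda(\vartheta))^2\ge\frac{\Lambda_i^2}{F_i+B_i+\mathcal I_i},$$ where $\Lambda_i=\int_{\mathbb R^l}\lambda_i'(\vartheta)\Phi(\vartheta)d\vartheta$, $F_i=\sum_{j=1}^n\int_{\mathbb R^l}(S'_{\vartheta,i}(x_j)/\sigma_j(\vartheta))^2\Phi(\vartheta)d\vartheta$, and $B_i=\frac12\sum_{j=1}^n\int_{\mathbb R^l}\frac{\tilde{\mathbf L}_i^2(x_j,\vartheta)}{\sigma_j^4(\vartheta)}\Phi(\vartheta)d\vartheta$ with $\tilde{\mathbf L}_i(x,\vartheta)=\mathbf L_{x,S_\vartheta}(S'_{\vartheta,i})$.
   Context: $\tilde{\mathbf E}G(Y,\vartheta)=\int_{\mathbb R^l}\mathbf E_\vartheta G(Y,\vartheta)\Phi(\vartheta)d\vartheta$, where $\mathbf E_\vartheta$ is expectation under the law of $Y=(y_1,\dots,y_n)$ for parameter $\vartheta$. Notation: $\|f\|^2=\int_0^1f^2$, $|f|_*=\sup_{0\le t\le1}|f(t)|$. $\mathbf H_1$ (for some integer $k\ge1$ and $r>0$, with $W_r^k$ the set of 1-periodic $k$ times differentiable $f:\mathbb R\to\mathbb R$ with $\sum_{j=0}^k\|f^{(j)}\|^2\le r$): $g:[0,1]\times L_1[0,1]\to\mathbb R_+$ is square integrable in $x$, $\varsigma(S)=\int_0^1g^2(x,S)dx$ satisfies $\lim_{n\to\infty}\sup_{S\in W_r^k}|n^{-1}\sum_{j=1}^ng^2(j/n,S)-\varsigma(S)|=0$,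 $\inf_{0\le x\le1}\inf_{S\in W_r^k}g^2(x,S)>0$ and $\sup_{S\in W_r^k}\varsigma(S)<\infty$. $\mathbf H_2$: for every $x\in[0,1]$, $g^2(x,\cdot):C[0,1]\to\mathbb R$ is Fréchet differentiable at every $f_0\in C[0,1]$: $g^2(x,f)=g^2(x,f_0)+\mathbf L_{x,f_0}(f-f_0)+\Upsilon(x,f_0,f)$ for $f$ near $f_0$, with $\mathbf L_{x,f_0}$ a bounded linear functional on $C[0,1]$ and $|\Upsilon(x,f_0,f)|/|f-f_0|_*\to0$ as $|f-f_0|_*\to0$. *)

(* Defs.v *)
From HB Require Import structures.
From mathcomp Require Import all_boot all_order all_algebra.
From mathcomp Require Import all_classical all_reals all_analysis.
Set Implicit Arguments. Unset Strict Implicit. Unset Printing Implicit Defensive.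
Import Order.TTheory GRing.Theory Num.Theory.
Import numFieldNormedType.Exports.
Local Open Scope classical_set_scope.
Local Open Scope ring_scope.

Section Defs.
Variable R : realType.
Local Notation mu := (@lebesgue_measure R).

Fixpoint iint (n : nat) : (n.-tuple R -> \bar R) -> \bar R :=
  match n return (n.-tuple R -> \bar R) -> \bar R with
  | 0 => fun f => f [tuple]
  | n'.+1 => fun f => (\int[mu]_t iint (fun s : n'.-tuple R => f (cons_tuple t s)))%E
  end.

Definition int_Rl (l : nat) (f : 'rV[R]_l -> \bar R) : \bar R :=
  iint (fun t : l.-tuple R => f (\row_(k < l) tnth t k)).

Definition supn01 (f : R -> R) : R := sup [set `|f t| | t in `[0%R, 1%R]].

Definition unitv (l : nat) (i : 'I_l) : 'rV[R]_l := delta_mx 0 i.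

Definition upd (l : nat) (th : 'rV[R]_l) (i : 'I_l) (t : R) : 'rV[R]_l :=
  \row_(k < l) (if k == i then t else th 0 k).

Definition Wrk (k : nat) (r : R) : set (R -> R) :=
  [set f : R -> R | (forall x, f (x + 1) = f x) /\
           (forall j x, (j < k)%N -> derivable (derive1n j f) x 1) /\
           (\sum_(j < k.+1) \int[mu]_(x in `[0%R, 1%R]) ((derive1n j f x) ^+ 2)%:E
              <= r%:E)%E].

Definition L1_01 (S : R -> R) : Prop := mu.-integrable `[0%R, 1%R] (fun x => (S x)%:E).

Definition varsig (g : R -> (R -> R) -> R) (S : R -> R) : R :=
  Rintegral mu `[0%R, 1%R] (fun x => g x S ^+ 2).

Definition H1 (g : R -> (R -> R) -> R) (k : nat) (r : R) : Prop :=
  (forall x S, x \in `[0%R, 1%R] -> L1_01 S -> 0 < g x S) /\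
  (forall S, L1_01 S ->
     mu.-integrable `[0%R, 1%R] (fun x => (g x S ^+ 2)%:E)) /\
  (forall eps : R, 0 < eps -> exists N : nat, forall n : nat, (N <= n)%N ->
     forall S, Wrk k r S ->
       `| n%:R^-1 * (\sum_(1 <= j < n.+1) g (j%:R / n%:R) S ^+ 2) - varsig g S |
         <= eps) /\
  (exists c : R, 0 < c /\ forall x S, x \in `[0%R, 1%R] -> Wrk k r S -> c <= g x S ^+ 2) /\
  (exists C : R, forall S, Wrk k r S -> varsig g S <= C).

Definition C01 (f : R -> R) : Prop := {within `[0%R, 1%R], continuous f}.

(* Condition H_2, with the Frechet derivative L x f0 given explicitly *)
Definition H2 (g : R -> (R -> R) -> R) (L : R -> (R -> R) -> (R -> R) -> R) : Prop :=
  forall x f0, x \in `[0%R, 1%R] -> C01 f0 ->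
    (forall (a b : R) h1 h2, C01 h1 -> C01 h2 ->
       L x f0 (fun t => a * h1 t + b * h2 t) = a * L x f0 h1 + b * L x f0 h2) /\
    (exists C : R, forall h, C01 h -> `| L x f0 h | <= C * supn01 h) /\
    (forall eps : R, 0 < eps -> exists delta : R, 0 < delta /\
       forall f, C01 f -> supn01 (fun t => f t - f0 t) < delta ->
         `| g x f ^+ 2 - g x f0 ^+ 2 - L x f0 (fun t => f t - f0 t) |
           <= eps * supn01 (fun t => f t - f0 t)).

Definition Phi (l : nat) (phi : 'I_l -> R -> R) (th : 'rV[R]_l) : R :=
  \prod_(i < l) phi i (th 0 i).

(* design points x_j = j/n, j = 1..n (index j : 'I_n stands for j+1) *)
Definition xpt (n : nat) (j : 'I_n) : R := (j.+1)%:R / n%:R.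

Definition sig (n l : nat) (g : R -> (R -> R) -> R) (S : 'rV[R]_l -> R -> R)
  (j : 'I_n) (th : 'rV[R]_l) : R := g (xpt j) (S th).

Definition obs (n l : nat) (g : R -> (R -> R) -> R) (S : 'rV[R]_l -> R -> R)
  (th : 'rV[R]_l) (xi : n.-tuple R) : n.-tuple R :=
  [tuple S th (xpt j) + sig g S j th * tnth xi j | j < n].

Definition Eth (n l : nat) (g : R -> (R -> R) -> R) (S : 'rV[R]_l -> R -> R)
  (G : n.-tuple R -> 'rV[R]_l -> R) (th : 'rV[R]_l) : \bar R :=
  iint (fun xi : n.-tuple R =>
    (G (obs g S th xi) th * \prod_(j < n) normal_pdf 0 1 (tnth xi j))%:E).

Definition Etilde (n l : nat) (g : R -> (R -> R) -> R) (S : 'rV[R]_l -> R -> R)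
  (phi : 'I_l -> R -> R) (G : n.-tuple R -> 'rV[R]_l -> R) : \bar R :=
  int_Rl (fun th => (Eth g S G th * (Phi phi th)%:E)%E).

End Defs.
Arguments unitv {R l}.
Arguments xpt {R n}.

(* Main.v *)
(* Let q(t, y) be the joint density of the parameter and of the observations,
   X = lamhat y - lam t, W = d/dt_i log q, and H = X q.  Then d/dt_i H = X W q - lam'_i q.
   Lebesgue measure is invariant under the translations t |-> t + s e_i, so integrating
   H(t + e_i, y) - H(t, y) = int_0^1 (d/dt_i H)(t + s e_i, y) ds over (t, y) shows that
   d/dt_i H has integral zero.  No condition on H at infinity is needed, only that H and
   d/dt_i H are integrable; but the partial derivatives need not be continuous, hence the
   fundamental theorem of calculus is used for an everywhere differentiable function whose
   derivative is merely Lebesgue integrable.  Thus Lambda_i = int X W q, and Cauchy-Schwarz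
   gives Lambda_i^2 <= (int X^2 q) (int W^2 q).  In the standardized observations the score
   is a sum of independent terms a xi + b (xi^2 - 1) of variance a^2 + 2 b^2, which yields
   int W^2 q = F_i + B_i + I_i. *)
Require Import Defs.
From HB Require Import structures.
From mathcomp Require Import all_boot all_order all_algebra.
From mathcomp Require Import all_classical all_reals all_analysis.
From mathcomp Require Import measurable_realfun.
From mathcomp Require Import ring lra.
Import Order.TTheory GRing.Theory Num.Theory.
Import numFieldNormedType.Exports.
Local Open Scope classical_set_scope.
Local Open Scope ring_scope.
Set Implicit Arguments.
Unset Strict Implicit.
Unset Printing Implicit Defensive.

(** Expectations are given as iterated integrals [iint] of arbitrary functions, so no order of
    integration can be exchanged before they are recognized as integrals against product Lebesgue
    measure on tuples, and this requires joint measurability. [S] comes only with partial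
    derivatives in the parameter, so the mean and the variance of an observation are merely known to
    be continuous in each coordinate of t separately; Borel measurability is extracted from that,
    and partial derivatives are then measurable as limits of difference quotients. Condition [H2]
    differentiates g^2 and not g, hence log-densities are written in terms of the variance. The
    prior score is the quotient phi_i' / phi_i, which division by zero makes 0 where phi_i vanishes.
    The risk, F and B may be infinite: the inequality lives in the extended reals, and the analytic
    argument is run only when risk and information are both finite, because this finiteness is what
    makes X q and X W q integrable. *)

(* The library only equips [m1 \x m2] with a finite-measure structure
   canonically; this alias carries the sigma-finite one. *)
Section sigma_finite_product.
Context d1 d2 (T1 : measurableType d1) (T2 : measurableType d2) (R : realType).
Variable m1 : {sigma_finite_measure set T1 -> \bar R}.
Variable m2 : {sigma_finite_measure set T2 -> \bar R}.

Definition sfprod : set (T1 * T2)%type -> \bar R := (m1 \x m2)%E.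

HB.instance Definition _ := Measure.on sfprod.

Lemma sfprod_sigma_finite : sigma_finite setT sfprod.
Proof.
exact: (isSigmaFinite.sigma_finiteT
 (lebesgue_integral_fubini.measure_function_Measure_isSigmaFinite__to__measure_function_isSigmaFinite
    m1 m2)).
Qed.

HB.instance Definition _ :=
  @Measure_isSigmaFinite.Build _ _ _ sfprod sfprod_sigma_finite.
End sigma_finite_product.

(** * Lebesgue measure on tuples and iterated integrals *)

Section tuple_lebesgue.
Context {R : realType}.
Local Notation mu := (@lebesgue_measure R).

Definition cons_pair n (p : (measurableTypeR R * n.-tuple R)%type) : n.+1.-tuple R :=
  cons_tuple p.1 p.2.

Lemma measurable_cons_pair n : measurable_fun setT (@cons_pair n).
Proof.
apply: (@measurable_cons _ _ _ _ fst n snd).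
exact: measurable_fst. exact: measurable_snd.
Qed.

Definition uncons n (t : n.+1.-tuple R) : (measurableTypeR R * n.-tuple R)%type :=
  (thead t, behead_tuple t).

Lemma measurable_uncons n : measurable_fun setT (@uncons n).
Proof.
apply/measurable_fun_pairP; split.
exact: (@measurable_tnth _ (measurableTypeR R) n.+1 ord0).
exact: (@measurable_behead _ (measurableTypeR R) n).
Qed.

Lemma cons_pairK n : cancel (@cons_pair n) (@uncons n).
Proof. by move=> [a t]; rewrite /uncons /cons_pair/= theadE; congr pair; apply/val_inj. Qed.

Section step.
Variables (n : nat) (m : {sigma_finite_measure set (n.-tuple R) -> \bar R}).

Definition cons_measure : set (n.+1.-tuple R) -> \bar R :=
  pushforward (sfprod mu m) (@cons_pair n).

Let pm : {measure set (n.+1.-tuple R) -> \bar R} :=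
  measure_function_pushforward__canonical__measure_function_Measure
    (sfprod mu m) (@measurable_cons_pair n).

HB.instance Definition _ := isMeasure.Build _ _ _ cons_measure
  (measure0 pm) (measure_ge0 pm) (@measure_semi_sigma_additive _ _ _ pm).

Lemma cons_measure_sigma_finite : sigma_finite setT cons_measure.
Proof.
have [F FT Foo] := sigma_finiteT (sfprod mu m).
exists (fun k => (@uncons n) @^-1` (F k)).
  by rewrite -preimage_bigcup -FT preimage_setT.
move=> k; have [mF Fk] := Foo k; split.
  by rewrite -[X in measurable X]setTI; apply: measurable_uncons.
rewrite /cons_measure /pushforward -comp_preimage.
by rewrite (_ : _ \o _ = id)//; apply/funext => p /=; rewrite cons_pairK.
Qed.

HB.instance Definition _ :=
  @Measure_isSigmaFinite.Build _ _ _ cons_measure cons_measure_sigma_finite.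
End step.

(** The recursion copies that of [iint], so the two can be compared one variable at a time; the base
    case is the unit mass on the only 0-tuple. *)
Fixpoint lebesgue_tuple n : {sigma_finite_measure set (n.-tuple R) -> \bar R} :=
  if n is n'.+1 then @cons_measure n' (lebesgue_tuple n') : {sigma_finite_measure set _ ->
    \bar R}
  else (\d_([tuple] : 0.-tuple R) : {sigma_finite_measure set _ -> \bar R}).

Lemma lebesgue_tuple0_integral (f : 0.-tuple R -> \bar R) : (\int[lebesgue_tuple 0]_t f t =
  f [tuple])%E.
Proof.
rewrite integral_dirac//; first by rewrite diracE in_setT mul1e.
by rewrite (_ : f = cst (f [tuple]))//; apply/funext => t; rewrite tuple0.
Qed.

Lemma ge0_lebesgue_tupleS n (f : n.+1.-tuple R -> \bar R) : measurable_fun setT f ->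
  (forall t, 0 <= f t)%E ->
  (\int[lebesgue_tuple n.+1]_t f t = \int[mu]_a \int[lebesgue_tuple n]_s f (cons_tuple a s))%E.
Proof.
move=> mf f0.
transitivity (\int[sfprod mu (lebesgue_tuple n)]_p (f \o @cons_pair n) p)%E.
  rewrite /= -[in RHS](preimage_setT (@cons_pair n)).
  by rewrite -(ge0_integral_pushforward (@measurable_cons_pair n)).
rewrite [LHS](@fubini_tonelli1 _ _ _ _ _ mu (lebesgue_tuple n) (f \o @cons_pair n))//.
  by apply: measurableT_comp => //; exact: measurable_cons_pair.
by move=> p /=.
Qed.

Lemma lebesgue_tupleS_integrable n (f : n.+1.-tuple R -> \bar R) : (lebesgue_tuple
  n.+1).-integrable setT f ->
  (sfprod mu (lebesgue_tuple n)).-integrable setT (f \o @cons_pair n).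
Proof.
move=> /integrableP[mf fi]; apply/integrableP; split.
  by apply: measurableT_comp => //; exact: measurable_cons_pair.
apply: le_lt_trans fi; rewrite ge0_lebesgue_tupleS//; last exact: measurableT_comp.
rewrite [leLHS](@fubini_tonelli1 _ _ _ _ _ mu (lebesgue_tuple n) (abse \o f \o @cons_pair n))//.
- apply: measurableT_comp; first exact: measurableT_comp.
  exact: measurable_cons_pair.
- by move=> p /=.
Qed.

Lemma lebesgue_tupleS_integral n (f : n.+1.-tuple R -> \bar R) : (lebesgue_tuple
  n.+1).-integrable setT f ->
  (\int[lebesgue_tuple n.+1]_t f t = \int[mu]_a \int[lebesgue_tuple n]_s f (cons_tuple a s))%E.
Proof.
move=> fi; have mf := measurable_int _ fi.
have fi' := lebesgue_tupleS_integrable fi.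
transitivity (\int[sfprod mu (lebesgue_tuple n)]_p (f \o @cons_pair n) p)%E.
  rewrite /= -[in RHS](preimage_setT (@cons_pair n)).
  by rewrite -(integral_pushforward (@measurable_cons_pair n)).
by rewrite -[LHS](@integral12_prod_meas1 _ _ _ _ _ mu (lebesgue_tuple n) (f \o @cons_pair n))//.
Qed.

(** The induction carries an arbitrary parameter space [T] and moves the first coordinate into it.
    Integrability does not enter: the integral of a signed function is by definition the difference
    of those of its positive and negative parts, and both depend measurably on the parameter. *)
Lemma measurable_iint d (T : measurableType d) n (f : T -> n.-tuple R -> \bar R) :
  measurable_fun setT (fun p : T * n.-tuple R => f p.1 p.2) ->
  measurable_fun setT (fun x => iint (f x)).
Proof.
elim: n d T f => [|n IH] d T f mf /=.
  pose h x : (T * 0.-tuple R) := (x, [tuple]).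
  rewrite (_ : (fun x => _) = (fun p => f p.1 p.2) \o h)//.
  by apply: measurableT_comp => //; exact: measurable_fun_pair.
pose g (p : T * measurableTypeR R) s := f p.1 (cons_tuple p.2 s).
have mg : measurable_fun setT (fun p => iint (g p)).
  apply: IH; rewrite /g.
  pose h (p : (T * measurableTypeR R) * n.-tuple R) : T * n.+1.-tuple R :=
    (p.1.1, cons_tuple p.1.2 p.2).
  rewrite (_ : (fun x => _) = (fun p => f p.1 p.2) \o h)//.
  apply: measurableT_comp => //; apply: measurable_fun_pair.
    exact: measurableT_comp.
  apply: (@measurable_cons _ _ _ _ (fun p : (T * measurableTypeR R) * n.-tuple R => p.1.2)
    n snd) => //.
  exact: measurableT_comp.
have mp : measurable_fun setT (fun x => \int[mu]_t ((fun p => iint (g p))^\+ (x, t)))%E.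
  by apply: measurable_fun_fubini_tonelli_F => //; exact: measurable_funepos.
have mn : measurable_fun setT (fun x => \int[mu]_t ((fun p => iint (g p))^\- (x, t)))%E.
  by apply: measurable_fun_fubini_tonelli_F => //; exact: measurable_funeneg.
rewrite [X in measurable_fun _ X](_ : _ =
  (fun x => \int[mu]_t ((fun p => iint (g p))^\+ (x, t)))
  \- (fun x => \int[mu]_t ((fun p => iint (g p))^\- (x, t))))%E.
  exact: emeasurable_funB.
apply/funext => x; rewrite [LHS]integralE.
by congr (_ - _)%E; apply: eq_integral => t _; rewrite ?funeposE ?funenegE.
Qed.

Lemma ge0_iintE n (f : n.-tuple R -> \bar R) : measurable_fun setT f ->
  (forall t, 0 <= f t)%E -> iint f = (\int[lebesgue_tuple n]_t f t)%E.
Proof.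
elim: n f => [|n IH] f mf f0; first by rewrite lebesgue_tuple0_integral.
rewrite ge0_lebesgue_tupleS//=; apply: eq_integral => a _; apply: IH => //.
apply: measurableT_comp => //.
by apply: (@measurable_cons _ _ _ _ (cst a) n id).
Qed.

(** By Fubini almost every section is integrable, and there the induction hypothesis applies; on the
    remaining null set [iint] may take any value. Comparing the outer integrals almost everywhere
    needs a measurable [iint], which [measurable_iint] provides. *)
Lemma iintE n (f : n.-tuple R -> \bar R) : (lebesgue_tuple n).-integrable setT f ->
  iint f = (\int[lebesgue_tuple n]_t f t)%E.
Proof.
elim: n f => [|n IH] f fi; first by rewrite lebesgue_tuple0_integral.
have mf := measurable_int _ fi.
have fi' := lebesgue_tupleS_integrable fi.
have mf' : measurable_fun setT (f \o @cons_pair n) := measurable_int _ fi'.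
rewrite lebesgue_tupleS_integral//=; apply: ae_eq_integral => //.
- exact: (measurable_iint (f := fun a s => f (cons_tuple a s))).
- exact: (@measurable_fubini_F _ _ _ _ _ mu (lebesgue_tuple n) (f \o @cons_pair n) fi').
- have := @ae_integrable1 _ _ _ _ _ mu (lebesgue_tuple n) (f \o @cons_pair n) fi'.
  by apply: filterS => a /= ai _; exact: IH.
Qed.

End tuple_lebesgue.

(** * Fundamental theorem of calculus for an integrable derivative *)

Section ftc_everywhere_differentiable.
Context {R : realType}.
Local Notation mu := (@lebesgue_measure R).
Implicit Types (f df w : R -> R).

Lemma is_derive_quotientP f (x l : R) : is_derive x 1 f l <->
  forall e : R, 0 < e -> exists2 d : R, 0 < d &
    forall h : R, h != 0 -> `|h| < d -> `|(f (h + x) - f x) / h - l| < e.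
Proof.
have quotE h : h^-1 *: ((f \o shift x) (h *: 1) - f x) = (f (h + x) - f x) / h.
  by rewrite /= /GRing.scale/= mulr1 mulrC.
split=> [[fx <-] e e0|H].
  move/cvgrPdist_lt : fx => /(_ _ e0)/nbhs_ballP[d /= d0 dH].
  exists d => // h h0 hd; rewrite distrC -quotE; apply: dH => //.
  by rewrite /ball/= sub0r normrN.
have cv : h^-1 *: ((f \o shift x) (h *: 1) - f x) @[h --> 0^'] --> l.
  apply/cvgrPdist_lt => e e0; have [d d0 dH] := H e e0.
  apply/nbhs_ballP; exists d => // h /=; rewrite /ball/= sub0r normrN => hd h0.
  by rewrite distrC quotE; exact: dH.
by split; [apply/cvg_ex; exists l|exact/cvg_lim].
Qed.

(** A continuity argument on the supremum c of the points satisfying [P]: c satisfies [P] because f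
    is continuous. If c < b, then just to the right of c the function f grows at a rate below w c +
    e while u stays above w c, so [P] would persist beyond c. *)
Lemma increment_le_integral_majorant f df w (u : R -> \bar R) (e a b : R) :
  (a <= b) -> (forall x : R, is_derive x 1 f (df x)) -> (forall x, df x <= w x) ->
  measurable_fun setT u -> (forall x, 0 <= u x)%E -> 0 < e ->
  (forall x, x \in `[a, b] -> exists2 d : R, 0 < d &
     forall t, t \in `[a, b] -> `|t - x| < d -> ((w x)%:E <= u t)%E) ->
  ((f b - f a)%:E <= \int[mu]_(t in `[a, b]) u t + (e * (b - a))%:E)%E.
Proof.
move=> ab fdf dfw mu_ u0 e0 uw.
pose P x := ((f x - f a)%:E <= \int[mu]_(t in `[a, x]) u t + (e * (x - a))%:E)%E.
pose A := [set x | (a <= x <= b) /\ P x].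
have Pa : P a.
  by rewrite /P !subrr mulr0 adde0; exact: integral_ge0.
have Aa : A a by split => //; rewrite lexx.
have supA : has_sup A.
  by split; [exists a|exists b => x [/andP[]]].
pose c := sup A.
have ac : a <= c by exact: ub_le_sup supA.2 _ Aa.
have cb : c <= b by apply: ge_sup => [|x [/andP[]]//]; exists a.
have fcont : continuous f.
  by move=> x; apply: differentiable_continuous; apply/derivable1_diffP; have [] := fdf x.
have uint s t : s <= t -> (\int[mu]_(x in `[a, s]) u x <= \int[mu]_(x in `[a, t]) u x)%E.
  move=> st; apply: ge0_subset_integral => //.
  - exact: measurable_funS mu_.
  - by move=> x/=; rewrite !in_itv/= => /andP[-> /=]; move/le_trans; exact.
have Pc : P c.
  rewrite /P; apply/lee_addgt0Pr => eps eps0.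
  have /cvgrPdist_lt/(_ _ eps0)/nbhs_ballP[d /= d0 dH] := fcont c.
  have [x [/andP[ax xb] Px] cx] := sup_adherent d0 supA.
  have xc : x <= c by apply: ub_le_sup supA.2 _ _; split => //; rewrite ax.
  have : `|f c - f x| < eps.
    by apply: dH; rewrite /ball/= ger0_norm ?subr_ge0// ltrBlDr -ltrBlDl.
  move=> /ltr_normlW fce.
  apply: (@le_trans _ _ ((f x - f a)%:E + eps%:E)%E).
    by rewrite -EFinD lee_fin; lra.
  apply: leeD => //; apply: (le_trans Px); apply: leeD; first exact: uint.
  by rewrite lee_fin ler_pM2l// lerB.
have [<-//|cneb] := eqVneq c b.
have ltcb : c < b by rewrite lt_neqAle cneb.
have [d1 d10 d1H] := uw c ltac:(by rewrite in_itv/= ac).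
have /is_derive_quotientP/(_ _ e0)[d2 d20 d2H] := fdf c.
(* Half the radii keep h strictly inside both neighbourhoods, and b - c keeps c + h in [a, b]. *)
pose h : R := Num.min (b - c) (Num.min (d1 / 2) (d2 / 2)).
have h0 : 0 < h by rewrite /h !lt_min subr_gt0 ltcb !divr_gt0.
have hb : h <= b - c by rewrite /h ge_min lexx.
have hd1 : h < d1 by rewrite /h !gt_min (_ : d1 / 2 < d1) ?orbT//; lra.
have hd2 : h < d2 by rewrite /h !gt_min (_ : d2 / 2 < d2) ?orbT//; lra.
have Pch : P (h + c).
  have := d2H h; rewrite gt_eqF// gtr0_norm// => /(_ isT hd2)/ltr_normlW.
  rewrite ltrBlDr ltr_pdivrMr// => fh.
  have iu : (\int[mu]_(t in `[a, c]) u t + (w c * h)%:E <= \int[mu]_(t in `[a, (h + c)%R])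
    u t)%E.
    have -> : `[a, (h + c)%R]%classic = `[a, c]%classic `|` `]c, (h + c)%R]%classic.
      by rewrite -itv_bndbnd_setU// bnd_simp//; lra.
    rewrite ge0_integral_setU//=; last 2 first.
    - exact: measurable_funS mu_.
    - by apply: lt_disjoint => x y /=; rewrite !in_itv/= => /andP[_ xc] /andP[+ _]; exact:
      le_lt_trans.
    apply: leeD => //.
    have -> : ((w c * h)%:E = \int[mu]_(t in `]c, (h + c)%R]) (w c)%:E)%E.
      rewrite integral_cst//= lebesgue_measure_itv/= lte_fin ltrDr h0.
      by rewrite -EFinD -EFinM addrK.
    have [wc|wc] := leP (w c) 0.
      apply: (@le_trans _ _ 0%E); last exact: integral_ge0.
      by rewrite integral_cst//= mule_le0_ge0.
    apply: ge0_le_integral => //=.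
    - by move=> x _; rewrite lee_fin ltW.
    - exact: measurable_funS mu_.
    - move=> x; rewrite in_itv/= => /andP[cx xch]; apply: d1H.
        by rewrite in_itv/=; apply/andP; split; lra.
      by rewrite gtr0_norm ?subr_gt0//; lra.
  rewrite /P; apply: (@le_trans _ _ ((f c - f a)%:E + (w c * h)%:E + (e * h)%:E)%E).
    rewrite -!EFinD lee_fin.
    have : df c * h <= w c * h by rewrite ler_pM2r.
    lra.
  have -> : ((e * (h + c - a))%:E = (e * (c - a))%:E + (e * h)%:E)%E.
    by rewrite -EFinD; congr (_%:E); ring.
  rewrite addeA leeD2r//; apply: le_trans (leeD2r _ iu).
  by rewrite addeAC leeD2r.
have : h + c <= c.
  apply: ub_le_sup supA.2 _ _; split => //; apply/andP; split; lra.
by rewrite gerDr leNgt h0.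
Qed.

(* Vitali-Caratheodory: [u] dominates [w x] on a neighbourhood of every [x].
   With E_k = {k e <= w < (k+1) e} and V_k open containing E_k, where V_k \ E_k is small,
   take u = w + e + sum_k (k+1) e 1_(V_k \ E_k). *)
Lemma local_majorant w (e a b : R) : a <= b -> measurable_fun setT w ->
  (forall x, 0 <= w x) -> 0 < e ->
  exists u : R -> \bar R, [/\ measurable_fun setT u, (forall x, 0 <= u x)%E,
    (forall x, x \in `[a, b] -> exists2 d : R, 0 < d &
     forall t, t \in `[a, b] -> `|t - x| < d -> ((w x)%:E <= u t)%E) &
    (\int[mu]_(t in `[a, b]) u t <=
     \int[mu]_(t in `[a, b]) (w t)%:E + (e * (b - a) + e)%:E)%E].
Proof.
move=> ab mw w0 e0.
pose E (k : nat) := `[a, b]%classic `&` (w @^-1` `[k%:R * e, k.+1%:R * e[%classic).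
have mE k : measurable (E k).
  by apply: measurableI => //; rewrite -[X in measurable X]setTI; exact: mw.
have Eoo k : (mu (E k) < +oo)%E.
  apply: (@le_lt_trans _ _ (mu `[a, b]%classic)).
    by apply: le_measure; [exact: (mem_set (mE k))|exact: (mem_set (measurable_itv `[a,
      b]))|exact: subIsetl].
  rewrite lebesgue_measure_itv/=; case: ifP => _; by rewrite ?ltry// -EFinD ltry.
(* Chosen so that (k+1) e del(k) = e / 2^(k+1); these terms sum to at most e. *)
pose del (k : nat) : R := (2 ^ k.+1)%:R^-1 / k.+1%:R.
have del0 k : 0 < del k by rewrite /del divr_gt0// invr_gt0 ltr0n expn_gt0.
have /choice[V HV] : forall k, exists U : set R,
    [/\ open U, E k `<=` U & (mu (U `\` E k) < (del k)%:E)%E].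
  by move=> k; exact: (lebesgue_regularity_outer (mE k) (Eoo k) (del0 k)).
have mV k : measurable (V k `\` E k).
  by apply: measurableD => //; apply: open_measurable; have [] := HV k.
pose s k t : \bar R := ((k.+1%:R * e)%:E * (\1_(V k `\` E k) t)%:E)%E.
have s0 k t : (0 <= s k t)%E by rewrite mule_ge0// lee_fin mulr_ge0// ltW.
have ms k : measurable_fun setT (s k).
  by apply: emeasurable_funM => //; apply/measurable_EFinP; exact: measurable_indic.
pose u t := (((w t)%:E + e%:E) + \sum_(0 <= k <oo) s k t)%E.
have msum : measurable_fun setT (fun t => \sum_(0 <= k <oo) s k t)%E.
  by apply: ge0_emeasurable_sum => // k t _ _; exact: s0.
have sum0 t : (0 <= \sum_(0 <= k <oo) s k t)%E by exact: nneseries_ge0.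
have mwe : measurable_fun setT (fun t => (w t)%:E + e%:E)%E.
  by apply: emeasurable_funD => //; exact/measurable_EFinP.
have we0 t : (0 <= (w t)%:E + e%:E)%E by rewrite -EFinD lee_fin addr_ge0// ltW.
exists u; split.
- exact: emeasurable_funD.
- by move=> x; rewrite /u adde_ge0.
- move=> x xab; pose k := Num.trunc (w x / e).
  have [wk1 wk2] : k%:R * e <= w x /\ w x < k.+1%:R * e.
    have := @truncn_itv _ (w x / e); rewrite (divr_ge0 (w0 x) (ltW e0)) => /(_ isT)/andP[h1 h2].
    by rewrite -ler_pdivlMr// -ltr_pdivrMr.
  have [oV EV _] := HV k.
  have xE : E k x by split => //=; rewrite in_itv/= wk1.
  have : nbhs x (V k) by apply: open_nbhs_nbhs; split => //; exact: EV.
  move=> /nbhs_ballP[d /= d0 dH]; exists d => // t tab td.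
  have tV : V k t by apply: dH; rewrite /ball/= distrC.
  (* On the level set of x the values of w differ by less than e, so w + e suffices; off it, t lies
     in V_k \ E_k and the k-th term alone contributes (k+1) e > w x. *)
  rewrite /u; have [tE|tE] := pselect (E k t).
    have /andP[wt _] : k%:R * e <= w t < k.+1%:R * e by have [_] := tE; rewrite /= in_itv.
    apply: (@le_trans _ _ ((w t)%:E + e%:E)%E); last by rewrite leeDl.
    rewrite -EFinD lee_fin (le_trans (ltW wk2))// -natr1 mulrDl mul1r lerD2r//.
  apply: (@le_trans _ _ (s k t)).
    by rewrite /s indicE mem_set// mule1 lee_fin ltW.
  apply: (@le_trans _ _ (\sum_(0 <= k <oo) s k t)%E); last by rewrite leeDr.
  by rewrite (@nneseriesD1 _ (s^~ t) k)// leeDl// nneseries_ge0.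
- rewrite /u ge0_integralD//=; last 2 first.
  + exact: measurable_funS mwe.
  + exact: measurable_funS msum.
  rewrite ge0_integralD//=; last 3 first.
  + by move=> x _; rewrite lee_fin.
  + by apply/measurable_EFinP; exact: measurable_funS mw.
  + by move=> x _; rewrite lee_fin ltW.
  rewrite -addeA leeD2l// EFinD leeD//.
    rewrite integral_cst//= lebesgue_measure_itv/=; case: ifP => _.
      by rewrite -EFinD -EFinM.
    by rewrite mule0 lee_fin mulr_ge0 ?subr_ge0// ltW.
  rewrite integral_nneseries//; last by move=> k; exact: measurable_funS (ms k).
  apply: (@le_trans _ _ (\sum_(0 <= k <oo) (e / (2 ^ k.+1)%:R)%:E)%E).
    apply: lee_nneseries => // k _.
      by move=> _; apply: integral_ge0.
    rewrite ge0_integralZl//=; last 2 first.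
    + by apply/measurable_EFinP; apply: measurable_indic; exact: mV.
    + by rewrite lee_fin mulr_ge0// ltW.
    rewrite integral_indic//; last exact: mV.
    apply: (@le_trans _ _ ((k.+1%:R * e)%:E * (del k)%:E)%E).
      rewrite lee_wpmul2l ?lee_fin ?(mulr_ge0 _ (ltW e0))//.
      have [_ _ lt] := HV k; apply: le_trans (ltW lt).
      apply: le_measure; [|exact: (mem_set (mV k))|exact: subIsetl].
      exact: (mem_set (measurableI _ _ (mV k) (measurable_itv `[a, b]))).
    rewrite -EFinM lee_fin /del.
    rewrite (_ : _ * _ * _ = e / (2 ^ k.+1)%:R)//.
    by rewrite [_ / k.+1%:R]mulrC mulrACA divff ?mul1r// pnatr_eq0.
  exact: epsilon_trick0 (ltW e0).
Qed.

Lemma increment_le_integral f df w (a b : R) :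
  a <= b -> (forall x : R, is_derive x 1 f (df x)) -> (forall x, df x <= w x) ->
  measurable_fun setT w -> (forall x, 0 <= w x) ->
  ((f b - f a)%:E <= \int[mu]_(t in `[a, b]) (w t)%:E)%E.
Proof.
move=> ab fdf dfw mw w0; apply/lee_addgt0Pr => eps eps0.
(* The majorant costs e (b - a) + e and the growth argument another e (b - a); together (2 (b - a) +
   1) e = eps. *)
pose e := eps / (2 * (b - a) + 1).
have ba0 : 0 <= b - a by rewrite subr_ge0.
have D0 : 0 < 2 * (b - a) + 1 by lra.
have e0 : 0 < e by rewrite divr_gt0.
have [u [mu_ u0 uw ule]] := local_majorant ab mw w0 e0.
apply: le_trans (increment_le_integral_majorant ab fdf dfw mu_ u0 e0 uw) _.
apply: le_trans (leeD2r _ ule) _; rewrite -addeA leeD2l// -EFinD lee_fin.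
by rewrite /e le_eqVlt; apply/orP; left; apply/eqP; field; lra.
Qed.

(** Truncating df from below at -N and adding N x to f makes the majorant nonnegative, so
    [increment_le_integral] applies. The added N (b - a) cancels, and N tends to infinity by
    dominated convergence under |df|. *)
Let ftc_le f df (a b : R) : a <= b -> (forall x : R, is_derive x 1 f (df x)) ->
  measurable_fun setT df -> mu.-integrable `[a, b] (EFin \o df) ->
  ((f b - f a)%:E <= \int[mu]_(t in `[a, b]) (df t)%:E)%E.
Proof.
move=> ab fdf mdf idf.
have absdf : mu.-integrable `[a, b] (abse \o (EFin \o df)) by exact: integrable_abse.
pose m (N : nat) x := Num.max (df x) (- N%:R).
have mm N : measurable_fun setT (m N) by exact: measurable_maxr.
have mabs N x : `|m N x| <= `|df x|.
  rewrite /m; have [h|h//] := ltP (df x) (- N%:R).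
  have N0 : (0 : R) <= N%:R by [].
  by rewrite normrN ger0_norm// ler0_norm; lra.
have leN N : ((f b - f a)%:E <= \int[mu]_(t in `[a, b]) (m N t)%:E)%E.
  have H := @increment_le_integral (fun x => f x + N%:R * x) (fun x => df x + N%:R) (fun x
    => m N x + N%:R) a b ab.
  have {}H : ((f b - f a + N%:R * (b - a))%:E <= \int[mu]_(t in `[a, b]) (m N t + N%:R)%:E)%E.
    rewrite (_ : f b - f a + _ = f b + N%:R * b - (f a + N%:R * a)); last by ring.
    apply: H.
    - move=> x; have dfx := fdf x; apply: is_deriveD.
      apply: is_derive_eq; by rewrite /GRing.scale/= mulr1.
    - by move=> x; rewrite lerD2r /m le_max lexx.
    - exact: measurable_funD.
    - by move=> x; rewrite -lerBlDr sub0r /m le_max lexx orbT.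
  have im : mu.-integrable `[a, b] (EFin \o m N).
    apply: le_integrable absdf => //.
      by apply/measurable_EFinP; exact: measurable_funS (mm N).
    by move=> x _ /=; rewrite lee_fin normr_id.
  have ic : mu.-integrable `[a, b] (EFin \o cst N%:R : R -> \bar R).
    apply/integrableP; split; first by apply/measurable_EFinP; exact: measurable_cst.
    rewrite /= integral_cst//= lebesgue_measure_itv/=.
    by case: ifP => _; rewrite ?mule0 ?ltry// -EFinD -EFinM ltry.
  move: H; under eq_integral do rewrite EFinD.
  rewrite integralD//= integral_cst//= lebesgue_measure_itv/= EFinD.
  have -> : (if (a%:E < b%:E)%E then (b%:E - a%:E)%E else 0%E) = (b - a)%:E.
    rewrite lte_fin; case: ltP => // ba.
    by rewrite (_ : b = a) ?subrr//; apply/eqP; rewrite eq_le ba ab.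
  by rewrite -EFinM leeD2rE.
have mD : measurable (`[a, b]%classic : set (measurableTypeR R)) by [].
have cv : (\int[mu]_(x in `[a, b]) (m N x)%:E)%E @[N --> \oo] -->
    (\int[mu]_(x in `[a, b]) (df x)%:E)%E.
  have [] // := @dominated_convergence _ _ _ mu _ mD
    (fun N x => (m N x)%:E) (fun x => (df x)%:E) (abse \o (EFin \o df)).
  - by move=> N; apply/measurable_EFinP; exact: measurable_funS (mm N).
  - by apply/measurable_EFinP; exact: measurable_funS mdf.
  - apply: aeW => x _; apply: cvg_near_cst.
    near=> N; rewrite /m; congr (_%:E); apply/max_idPl.
    rewrite -lerNl; near: N; exact: nbhs_infty_ger.
  - by apply: aeW => x N _ /=; rewrite lee_fin.
rewrite -(cvg_lim _ cv)//; apply: lime_ge; first by apply/cvg_ex; eexists; exact: cv.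
exact: nearW.
Unshelve. all: by end_near. Qed.

(** The opposite inequality is [ftc_le] for -f. *)
Lemma integral_is_derive f df (a b : R) : a <= b -> (forall x : R, is_derive x 1 f (df x)) ->
  measurable_fun setT df -> mu.-integrable `[a, b] (EFin \o df) ->
  (\int[mu]_(t in `[a, b]) (df t)%:E = (f b - f a)%:E)%E.
Proof.
move=> ab fdf mdf idf; apply/eqP; rewrite eq_le ftc_le// andbT.
have mNdf : measurable_fun setT (fun x => - df x) by exact: measurableT_comp.
have iNdf : mu.-integrable `[a, b] (EFin \o (fun x => - df x)).
  by apply: eq_integrable (integrableN idf) => // x _ /=; rewrite EFinN.
have := @ftc_le (fun x => - f x) (fun x => - df x) a b ab (fun x => is_deriveN (fdf x))
  mNdf iNdf.
under eq_integral do rewrite EFinN.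
rewrite integralN/=; last exact: integrable_add_def.
by rewrite leeNr -EFinN opprB opprK addrC.
Qed.
End ftc_everywhere_differentiable.

(** * Derivatives along a measure-preserving flow *)

Section flow_invariance.
Context d (X : measurableType d) (R : realType).
Variable M : {sigma_finite_measure set X -> \bar R}.
Variable T : R -> X -> X.
Local Notation mu := (@lebesgue_measure R).
Hypothesis mT : measurable_fun setT (fun p : (measurableTypeR R * X)%type => T p.1 p.2).
Hypothesis T0 : forall x, T 0 x = x.
Hypothesis TM : forall s (f : X -> \bar R), measurable_fun setT f ->
  (forall x, 0 <= f x)%E -> (\int[M]_x f (T s x) = \int[M]_x f x)%E.

Let mTs s : measurable_fun setT (T s).
Proof.
rewrite (_ : T s = (fun p : (measurableTypeR R * X)%type => T p.1 p.2) \o (pair s))//.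
by apply: measurableT_comp => //; exact: measurable_fun_pair.
Qed.

Lemma integral_flow s (f : X -> \bar R) : measurable_fun setT f ->
  (\int[M]_x f (T s x) = \int[M]_x f x)%E.
Proof.
move=> mf; rewrite integralE [RHS]integralE; congr (_ - _)%E.
  by rewrite -(TM s (measurable_funepos mf))//; apply: eq_integral => x _; rewrite !funeposE.
by rewrite -(TM s (measurable_funeneg mf))//; apply: eq_integral => x _; rewrite !funenegE.
Qed.

Lemma integrable_flow s (f : X -> \bar R) :
  M.-integrable setT f -> M.-integrable setT (fun x => f (T s x)).
Proof.
move=> /integrableP[mf fi]; apply/integrableP; split.
  exact: (measurableT_comp mf (mTs s)).
have -> : (\int[M]_x `|f (T s x)| = \int[M]_x `|f x|)%E; last by [].
by apply: (TM s (f := abse \o f)) => [|x /=]; [exact: measurableT_comp|].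
Qed.

(* Integrate H (T 1 x) - H x = int_0^1 DH (T s x) ds over x. *)
Lemma integral_flow_derivative (H DH : X -> R) :
  M.-integrable setT (EFin \o H) -> M.-integrable setT (EFin \o DH) ->
  (forall x (s : R), is_derive s 1 (fun s => H (T s x)) (DH (T s x))) ->
  (\int[M]_x (DH x)%:E = 0)%E.
Proof.
move=> iH iDH HDH.
have mDH : measurable_fun setT DH by apply/measurable_EFinP; exact: measurable_int iDH.
have mH : measurable_fun setT H by apply/measurable_EFinP; exact: measurable_int iH.
pose I01 : set (measurableTypeR R) := `[0%R, 1%R]%classic.
have mI : measurable I01 by exact: measurable_itv.
pose G (p : (measurableTypeR R * X)%type) : \bar R :=
  ((DH (T p.1 p.2))%:E * (\1_I01 p.1)%:E)%E.
have mDHT : measurable_fun setT (fun p : (measurableTypeR R * X)%type => DH (T p.1 p.2)).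
  exact: (measurableT_comp mDH mT).
have m1 : measurable_fun setT (fun p : (measurableTypeR R * X)%type => (\1_I01 p.1 : R)).
  by apply: (measurableT_comp (measurable_indic mI)).
have mG : measurable_fun setT G.
  by apply: emeasurable_funM; apply/measurable_EFinP.
have mu01 : mu I01 = 1%E by rewrite /I01 lebesgue_measure_itv/= lte_fin ltr01 oppr0 adde0.
have int1 : (\int[mu]_s (\1_I01 s)%:E = 1)%E by rewrite integral_indic// setIT; exact: mu01.
(* By invariance the L1 norm of x |-> DH (T s x) is the same for every s, so cutting s down to
   [0, 1] makes [G] integrable on the product and Fubini applicable. *)
have iG : (mu \x M)%E.-integrable setT G.
  apply/integrable12ltyP => //.
  rewrite (_ : (\int[mu]_x _)%E = (\int[M]_x `|(DH x)%:E|)%E); last first.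
    transitivity (\int[mu]_s ((\int[M]_x `|(DH x)%:E|) * (\1_I01 s)%:E))%E.
      apply: eq_integral => s _; rewrite /G/=.
      under eq_integral do rewrite normrM (@ger0_norm _ (\1_I01 s))// EFinM.
      rewrite ge0_integralZr//; last by apply/measurable_EFinP; apply: measurableT_comp => //;
        exact: (measurableT_comp mDH (mTs s)).
      congr (_ * _)%E; apply: (TM s (f := fun x => `|DH x|%:E)) => //.
      by apply/measurable_EFinP; exact: measurableT_comp.
    rewrite ge0_integralZl//; last 2 first.
    - by apply/measurable_EFinP; exact: measurable_indic.
    - exact: integral_ge0.
    by rewrite int1 mule1.
  by have /integrableP[_] := iDH.
have iHT : M.-integrable setT (fun x => (H (T 1 x))%:E) by exact: (integrable_flow 1 iH).
transitivity (\int[mu]_s \int[M]_x G (s, x))%E.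
  transitivity (\int[mu]_s ((\int[M]_x (DH x)%:E) * (\1_I01 s)%:E))%E.
    rewrite -(fineK (integrable_fin_num _ iDH))// integralZl//= ?int1 ?mule1//.
    apply/integrableP; split; first by apply/measurable_EFinP; exact: measurable_indic.
    by under eq_integral do rewrite gee0_abs//; rewrite int1 ltry.
  apply: eq_integral => s _; rewrite (_ : (\int[M]_x G (s, x))%E =
      (\int[M]_x ((DH (T s x))%:E * (\1_I01 s)%:E))%E)// integralZr//; last exact:
        (integrable_flow s iDH).
  by rewrite (integral_flow s (f := fun x => (DH x)%:E))//; apply/measurable_EFinP.
transitivity (\int[M]_x \int[mu]_s G (s, x))%E; first exact: Fubini.
transitivity (\int[M]_x ((H (T 1 x))%:E - (H x)%:E))%E.
  apply: ae_eq_integral => //.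
  - exact: (measurable_fubini_G iG).
  - by apply/measurable_EFinP; apply: measurable_funB => //; exact: (measurableT_comp mH
    (mTs 1)).
  (* Fubini makes s |-> DH (T s x) integrable on [0, 1] only for almost every x; the fundamental
     theorem is applied on those orbits. *)
  - have := ae_integrable2 iG; apply: filterS => x /= ix _.
    have GE s : G (s, x) = (((fun s => (DH (T s x))%:E) \_ I01) s)%E.
      by rewrite epatch_indic.
    have ix' : mu.-integrable I01 (fun s => (DH (T s x))%:E).
      by apply/integrable_mkcond => //; apply: eq_integrable ix => // s _; rewrite GE.
    under eq_integral do rewrite GE.
    rewrite -integral_mkcond (@integral_is_derive _ (fun s => H (T s x)) (fun s => DH (T s
      x)) 0 1)//.
      by rewrite T0 EFinB.
    exact: (measurableT_comp mDHT (measurable_fun_pair (@measurable_id _ _ _)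
      (measurable_cst x))).
rewrite integralB//= (integral_flow 1 (f := fun x => (H x)%:E)); last exact/measurable_EFinP.
by rewrite subee// integrable_fin_num.
Qed.

End flow_invariance.

(** * Measurability of functions continuous in one variable *)

Section caratheodory_function.
Context d (X : measurableType d) (R : realType).

(** Rounding s down to the grid of mesh 1/(m+1) gives measurable functions, assembled from countably
    many strips on which s is frozen; continuity in s makes them converge pointwise to f. *)
Lemma measurable_caratheodory (f : X -> R -> R) :
  (forall s, measurable_fun setT (f ^~ s)) -> (forall x, continuous (f x)) ->
  measurable_fun setT (fun p : (measurableTypeR R * X)%type => f p.2 p.1).
Proof.
move=> mf cf.
pose q (m : nat) (k : int) : R := k%:~R / m.+1%:R.
pose g (m : nat) (s : R) : R := q m (Num.floor (s * m.+1%:R)).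
have gs m s : `|s - g m s| <= m.+1%:R^-1.
  have m0 : (0 : R) < m.+1%:R by [].
  have /andP[h1 h2] := floor_itv (s * m.+1%:R).
  rewrite /g /q ger0_norm ?subr_ge0; last by rewrite ler_pdivrMr.
  rewrite lerBlDr -(ler_pM2r m0) mulrDl mulVf ?gt_eqF// mulfVK ?gt_eqF//.
  by rewrite addrC; move: h2; rewrite intrD => /ltW.
apply: (@measurable_fun_cvg _ _ _ _ (fun m p => f p.2 (g m p.1))).
- move=> m _ Y mY; rewrite setTI.
  have -> : (fun p : (measurableTypeR R * X)%type => f p.2 (g m p.1)) @^-1` Y =
     \bigcup_(k : int) ((fun s : measurableTypeR R => Num.floor (s * m.+1%:R)) @^-1` [set k]
       `*` (f ^~ (q m k)) @^-1` Y).
    apply/seteqP; split => [[s x] /= fY|[s x] /= [k _ [/= sk]]].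
      by exists (Num.floor (s * m.+1%:R)).
    by rewrite /g sk.
  apply: countable_bigcupT_measurable => [|k]; first exact: countableP.
  apply: measurableX; last by rewrite -[X in measurable X]setTI; exact: mf.
  rewrite (_ : _ @^-1` _ = `[q m k, q m (k + 1)%R[%classic); first exact: measurable_itv.
  apply/seteqP; split => s /=; rewrite in_itv/= /q ler_pdivrMr// ltr_pdivlMr//.
    by move=> <-; exact: floor_itv.
  by move=> /floor_def.
- move=> [s x] _ /=; apply: (cvg_comp (fun m => g m s) (f x)); last exact: cf.
  apply/cvgrPdist_le => e e0; near=> m.
  apply: le_trans (gs m s) _; near: m.
  have /cvgrPdist_lt/(_ _ e0) := @cvg_harmonic R.
  by apply: filterS => m; rewrite sub0r normrN => /ltW; apply: le_trans; exact: ler_norm.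
Unshelve. all: by end_near. Qed.

End caratheodory_function.

(** * Shifts of one coordinate, separate continuity and partial derivatives *)

Section coordinate_shift.
Context {R : realType}.

Definition tshift l (i : 'I_l) (h : R) (t : l.-tuple R) : l.-tuple R :=
  [tuple tnth t k + (k == i)%:R * h | k < l].

Lemma tnth_tshift l (i : 'I_l) h t k :
  tnth (tshift i h t) k = tnth t k + (k == i)%:R * h.
Proof. by rewrite tnth_mktuple. Qed.

Lemma tshift0 l (i : 'I_l) t : tshift i 0 t = t.
Proof. by apply: eq_from_tnth => k; rewrite tnth_mktuple mulr0 addr0. Qed.

Lemma tshiftD l (i : 'I_l) a b t : tshift i (a + b) t = tshift i a (tshift i b t).
Proof. by apply: eq_from_tnth => k; rewrite !tnth_mktuple; ring. Qed.

(** Shifts along one coordinate form a group action, so derivatives at 0 for all base points yield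
    derivatives along the entire line. *)
Lemma is_derive_tshift l (i : 'I_l) (f df : l.-tuple R -> R) :
  (forall t, is_derive (0 : R) 1 (fun h => f (tshift i h t)) (df t)) ->
  forall t (x : R), is_derive x 1 (fun h => f (tshift i h t)) (df (tshift i x t)).
Proof.
move=> fdf t x; apply/is_derive_quotientP => e e0.
have /is_derive_quotientP/(_ _ e0)[d d0 dH] := fdf (tshift i x t).
exists d => // h h0 hd; have := dH h h0 hd.
by rewrite addr0 tshift0 -tshiftD.
Qed.

Lemma tshift_cons0 l h a (s : l.-tuple R) :
  tshift ord0 h (cons_tuple a s) = cons_tuple (a + h) s.
Proof.
apply: eq_from_tnth => k; rewrite tnth_mktuple.
case: (unliftP ord0 k) => [j ->|->]; last by rewrite !tnth0 eqxx mul1r.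
by rewrite !tnthS eq_sym (negbTE (neq_lift _ _)) mul0r addr0.
Qed.

Lemma tshift_consS l (i : 'I_l) h a (s : l.-tuple R) :
  tshift (lift ord0 i) h (cons_tuple a s) = cons_tuple a (tshift i h s).
Proof.
apply: eq_from_tnth => k; rewrite tnth_mktuple.
case: (unliftP ord0 k) => [j ->|->].
  by rewrite !tnthS tnth_mktuple (inj_eq lift_inj).
by rewrite !tnth0 (negbTE (neq_lift _ _)) mul0r addr0.
Qed.

Lemma measurable_tshift l (i : 'I_l) :
  measurable_fun setT (fun p : (measurableTypeR R * l.-tuple R)%type => tshift i p.1 p.2).
Proof.
apply/measurable_fun_tnthP => k.
rewrite (_ : _ \o _ = fun p : (measurableTypeR R * l.-tuple R)%type =>
   tnth p.2 k + (k == i)%:R * p.1); last first.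
  by apply/funext => p /=; rewrite tnth_mktuple.
apply: measurable_funD; last exact: measurable_funM.
by apply: (measurableT_comp (@measurable_tnth _ R l k)).
Qed.

(** Such an f need not be continuous. The first coordinate plays the continuous variable of
    [measurable_caratheodory], and the induction hypothesis gives measurability in the remaining
    ones. *)
Lemma measurable_separately_continuous l (f : l.-tuple R -> R) :
  (forall i t, continuous (fun h => f (tshift i h t))) -> measurable_fun setT f.
Proof.
elim: l f => [|l IH] f cf.
  by rewrite (_ : f = cst (f [tuple]))//; apply/funext => t; rewrite tuple0.
have -> : f = (fun p : (measurableTypeR R * l.-tuple R)%type =>
   f (cons_tuple p.1 p.2)) \o @uncons R l.
  by apply/funext => t /=; rewrite {1}(tuple_eta t).
apply: measurableT_comp; last exact: measurable_uncons.
apply: (@measurable_caratheodory _ _ R (fun s a => f (cons_tuple a s))).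
  move=> a; apply: IH => i t; have := cf (lift ord0 i) (cons_tuple a t).
  rewrite (_ : (fun h => _) = (fun h => f (cons_tuple a (tshift i h t))))//.
  by apply/funext => h; rewrite tshift_consS.
move=> s; have := cf ord0 (cons_tuple 0 s).
rewrite (_ : (fun h => _) = (fun a => f (cons_tuple a s)))//.
by apply/funext => h; rewrite tshift_cons0 add0r.
Qed.

(** Pointwise limit of the difference quotients with step 1/(m+1). *)
Lemma measurable_partial_derivative l (f df : l.-tuple R -> R) (i : 'I_l) :
  measurable_fun setT f ->
  (forall t, is_derive (0 : R) 1 (fun h => f (tshift i h t)) (df t)) ->
  measurable_fun setT df.
Proof.
move=> mf fdf.
apply: (@measurable_fun_cvg _ _ _ _
  (fun m t => (f (tshift i m.+1%:R^-1 t) - f t) / m.+1%:R^-1)).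
  move=> m; apply: measurable_funM => //; apply: measurable_funB => //.
  apply: (measurableT_comp mf).
  exact: (measurableT_comp (measurable_tshift i) (measurable_fun_pair (measurable_cst _)
    (@measurable_id _ _ _))).
move=> t _; apply/cvgrPdist_lt => e e0.
have /is_derive_quotientP/(_ _ e0)[dd d0 H] := fdf t.
near=> m; have := H m.+1%:R^-1; rewrite addr0 tshift0 distrC; apply => //.
rewrite gtr0_norm//; near: m.
have /cvgrPdist_lt/(_ _ d0) := @cvg_harmonic R.
by apply: filterS => m; rewrite sub0r normrN; apply: le_lt_trans; exact: ler_norm.
Unshelve. all: by end_near. Qed.

End coordinate_shift.

(** * Affine changes of variable and translation invariance *)

Section affine_change_of_variables.
Context {R : realType}.
Local Notation mu := (@lebesgue_measure R).

Let aff (m s : R) : measurableTypeR R -> measurableTypeR R := fun x => m + s * x.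

Let maff m s : measurable_fun setT (aff m s).
Proof. by apply: measurable_funD => //; exact: measurable_funM. Qed.

(** The image of Lebesgue measure under x |-> m + s x, multiplied by s, has the right values on
    half-open intervals, and these determine Lebesgue measure. *)
Lemma lebesgue_measure_affine (m s : R) (A : set (measurableTypeR R)) : 0 < s ->
  measurable A -> (mu A = s%:E * mu ((fun x => (m + s * x)%R) @^-1` A))%E.
Proof.
move=> s0 mA; pose sn := NngNum (ltW s0).
pose nu : {measure set (measurableTypeR R) -> \bar R} :=
  mscale sn (measure_function_pushforward__canonical__measure_function_Measure mu (maff m s)).
rewrite (@lebesgue_measure_unique _ nu)//.
move=> _ [[a b]] _ <-; rewrite /nu/= /mscale/= /pushforward.
rewrite (_ : aff m s @^-1` `]a, b] = `](a - m) / s, (b - m) / s]%classic); last first.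
  apply/seteqP; split => x /=; rewrite !in_itv/= /aff ltr_pdivrMr// ler_pdivlMr//
    ltrBlDl lerBrDl ![x * s]mulrC//.
rewrite !lebesgue_measure_itv/= !lte_fin ltr_pM2r ?invr_gt0// ltrD2r.
case: ifP => _; last by rewrite mule0.
by rewrite -!EFinD -EFinM; congr (_%:E); field; rewrite gt_eqF.
Qed.

Lemma ge0_integral_affine (m s : R) (f : R -> \bar R) : 0 < s ->
  measurable_fun setT f -> (forall x, 0 <= f x)%E ->
  (\int[mu]_x f x = s%:E * \int[mu]_x f (m + s * x)%R)%E.
Proof.
move=> s0 mf f0; pose sn := NngNum (ltW s0).
pose nu : {measure set (measurableTypeR R) -> \bar R} :=
  measure_function_pushforward__canonical__measure_function_Measure mu (maff m s).
transitivity (\int[mscale sn nu]_x f x)%E.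
  by apply: eq_measure_integral => A mA _ /=; rewrite (lebesgue_measure_affine m s0).
rewrite ge0_integral_mscale//=; congr (_ * _)%E.
rewrite -[in RHS](preimage_setT (aff m s)).
by rewrite -(ge0_integral_pushforward (maff m s)).
Qed.

Lemma ge0_integral_translation (h : R) (f : R -> \bar R) :
  measurable_fun setT f -> (forall x, 0 <= f x)%E ->
  (\int[mu]_x f (x + h)%R = \int[mu]_x f x)%E.
Proof.
move=> mf f0; rewrite (ge0_integral_affine h ltr01 mf f0) mul1e.
by apply: eq_integral => x _; rewrite mul1r addrC.
Qed.

Lemma ge0_integral_tshift l (i : 'I_l) (h : R) (f : l.-tuple R -> \bar R) :
  measurable_fun setT f -> (forall t, 0 <= f t)%E ->
  (\int[lebesgue_tuple l]_t f (tshift i h t) = \int[lebesgue_tuple l]_t f t)%E.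
Proof.
elim: l i f => [[]//|l IH] i f mf f0.
have mcons a : measurable_fun setT (fun s : l.-tuple R => f (cons_tuple a s)).
  by apply: (measurableT_comp mf); apply: (@measurable_cons _ _ _ _ (cst a) l id).
have mfs : measurable_fun setT (fun t => f (tshift i h t)).
  apply: (measurableT_comp mf).
  exact: (measurableT_comp (measurable_tshift i) (measurable_fun_pair (measurable_cst _)
    (@measurable_id _ _ _))).
rewrite ge0_lebesgue_tupleS// [RHS]ge0_lebesgue_tupleS//.
case: (unliftP ord0 i) mfs => [j ->|->] mfs.
  apply: eq_integral => a _; rewrite -(IH j (fun s => f (cons_tuple a s)))//.
  by apply: eq_integral => s _; rewrite tshift_consS.
transitivity (\int[mu]_a \int[lebesgue_tuple l]_s f (cons_tuple (a + h)%R s))%E.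
  by apply: eq_integral => a _; apply: eq_integral => s _; rewrite tshift_cons0.
apply: (@ge0_integral_translation h (fun a => \int[lebesgue_tuple l]_s f (cons_tuple a s))%E).
  exact: (@measurable_fun_fubini_tonelli_F _ _ _ _ _ (lebesgue_tuple l)
    (f \o @cons_pair R l) (measurableT_comp mf (@measurable_cons_pair R l)) (fun p => f0 _)).
by move=> a; exact: integral_ge0.
Qed.

End affine_change_of_variables.

(** * The normal density and its logarithm *)

Section normal_log_density.
Context {R : realType}.
Local Notation mu := (@lebesgue_measure R).

(** The parameter [v] is the variance and not the standard deviation, since the variance is what
    [H2] allows to differentiate. *)
Definition normal_logd (m v y : R) : R :=
  - (ln (v * pi *+ 2) / 2) - (y - m) ^+ 2 / (v *+ 2).

Lemma normal_pdf_expR (m s y : R) : 0 < s ->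
  normal_pdf m s y = expR (normal_logd m (s ^+ 2) y).
Proof.
move=> s0; rewrite normal_pdfE ?gt_eqF//; rewrite /normal_peak /normal_fun /normal_logd.
have p0 : 0 < s ^+ 2 * pi *+ 2 by rewrite mulrn_wgt0// mulr_gt0 ?pi_gt0// exprn_gt0.
rewrite expRD mulNr; congr (_ * _).
rewrite expRN; congr (_^-1).
apply/eqP; rewrite -(@eqrXn2 _ 2) ?sqrtr_ge0 ?expR_ge0//.
by rewrite sqr_sqrtr ?ltW// -expRM_natl [X in expR X]mulrC mulfVK// lnK.
Qed.

Lemma normal_pdf_affine (m s a : R) : 0 < s ->
  s * normal_pdf m s (m + s * a) = normal_pdf 0 1 a.
Proof.
move=> s0; rewrite !normal_pdfE ?oner_neq0 ?gt_eqF//.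
rewrite /normal_peak /normal_fun mulrA; congr (_ * expR _).
  rewrite expr1n mul1r -mulrnAr sqrtrM ?sqr_ge0// sqrtr_sqr gtr0_norm//.
  by rewrite invfM mulrA divff ?mul1r// gt_eqF.
by rewrite expr1n subr0 (addrC m) addrK; field; rewrite gt_eqF.
Qed.

Lemma ge0_integral_normal_affine (m s : R) (f : R -> \bar R) : 0 < s ->
  measurable_fun setT f -> (forall x, 0 <= f x)%E ->
  (\int[mu]_a (f (m + s * a)%R * (normal_pdf 0 1 a)%:E) =
   \int[mu]_y (f y * (normal_pdf m s y)%:E))%E.
Proof.
move=> s0 mf f0.
have mp : measurable_fun setT (fun y => f y * (normal_pdf m s y)%:E)%E.
  by apply: emeasurable_funM => //; apply/measurable_EFinP; exact: measurable_normal_pdf.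
have maff : measurable_fun setT (fun x : R => m + s * x).
  by apply: measurable_funD => //; exact: measurable_funM.
rewrite (ge0_integral_affine m s0 mp); last first.
  by move=> x; rewrite mule_ge0// lee_fin normal_pdf_ge0.
rewrite -ge0_integralZl//=; last 3 first.
- exact: (measurableT_comp mp maff).
- by move=> x _; rewrite mule_ge0// lee_fin normal_pdf_ge0.
- by rewrite lee_fin ltW.
by apply: eq_integral => a _; rewrite muleCA -EFinM normal_pdf_affine.
Qed.

End normal_log_density.

(** * Gaussian integrals of quadratic polynomials *)

Section gaussian_moments.
Context {R : realType}.
Local Notation mu := (@lebesgue_measure R).
Local Notation nphi := (normal_pdf (0 : R) 1).

Lemma integrable_quartic_normal (f : R -> R) (C : R) :
  measurable_fun setT f -> (forall x, `|f x| <= C * (1 + x ^+ 4)) ->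
  mu.-integrable setT (fun x => (f x * nphi x)%:E).
Proof.
move=> mf fC.
have C0 : 0 <= C.
  by have := le_trans (normr_ge0 _) (fC 0); rewrite expr0n/= addr0 mulr1.
(* The comparison is with the normal density of standard deviation 2. The exponents differ by 3 x^2
   / 8 = 2 u with u = 3 x^2 / 16, and u^2 <= exp(2 u) absorbs x^4 = (16/3)^2 u^2. *)
pose D : R := 1 + (16 / 3) ^+ 2.
have key x : (1 + x ^+ 4) * normal_fun 0 1 x <= D * normal_fun 0 2 x.
  pose u := 3 * x ^+ 2 / 16.
  have -> : normal_fun 0 1 x = (expR u ^+ 2)^-1 * normal_fun 0 2 x.
    rewrite /normal_fun -expRM_natl -expRN -expRD; congr expR.
    by rewrite /u; field.
  rewrite mulrA ler_wpM2r ?expR_ge0// ler_pdivrMr ?exprn_gt0 ?expR_gt0//.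
  have u0 : 0 <= u by rewrite /u; have := sqr_ge0 x; lra.
  have eu : 1 + u <= expR u := expR_ge1Dx u.
  have -> : x ^+ 4 = (16 / 3) ^+ 2 * u ^+ 2 by rewrite /u; field.
  have e1 : 1 <= expR u ^+ 2 by nra.
  have e2 : u ^+ 2 <= expR u ^+ 2 by nra.
  rewrite [leRHS]mulrDl mul1r; apply: lerD => //.
  by apply: ler_wpM2l => //; exact: sqr_ge0.
have p2 : 0 < normal_peak (2 : R) by apply: normal_peak_gt0; rewrite pnatr_eq0.
have p1 : 0 <= normal_peak (1 : R) by exact: normal_peak_ge0.
pose K := C * D * normal_peak 1 / normal_peak 2.
have D0 : 0 <= D by rewrite addr_ge0// sqr_ge0.
have K0 : 0 <= K by rewrite /K divr_ge0 ?(ltW p2)// !mulr_ge0.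
have bound x : `|f x * nphi x| <= K * normal_pdf 0 2 x.
  rewrite normrM (ger0_norm (normal_pdf_ge0 _ _ _)).
  apply: le_trans (ler_wpM2r (normal_pdf_ge0 _ _ _) (fC x)) _.
  rewrite !normal_pdfE ?oner_neq0 ?pnatr_eq0//.
  have -> : C * (1 + x ^+ 4) * (normal_peak 1 * normal_fun 0 1 x) =
    (C * normal_peak 1) * ((1 + x ^+ 4) * normal_fun 0 1 x) by ring.
  have -> : K * (normal_peak 2 * normal_fun 0 2 x) = (C * normal_peak 1) * (D * normal_fun
    0 2 x).
    by rewrite /K; field; rewrite gt_eqF.
  by apply: ler_wpM2l => //; exact: mulr_ge0.
apply: (@le_integrable _ _ _ mu setT measurableT _ (fun x => (K * normal_pdf 0 2 x)%:E)).
- by apply/measurable_EFinP; apply: measurable_funM => //; exact: measurable_normal_pdf.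
- move=> x _ /=; rewrite lee_fin; apply: le_trans (bound x) _; exact: ler_norm.
- under eq_fun do rewrite EFinM.
  by apply: integrableZl => //; exact: integrable_normal_pdf.
Qed.

Lemma is_derive_translate (f : R -> R) (x s l : R) :
  is_derive (x + s) 1 f l -> is_derive s 1 (fun s => f (x + s)) l.
Proof.
move=> /is_derive_quotientP H; apply/is_derive_quotientP => e e0.
by have [d d0 dH] := H e e0; exists d => // h h0 hd; rewrite addrCA; exact: dH.
Qed.

(** The polynomials x and x^2 - 1 are centred and orthogonal under the standard normal law, with
    squared norms 1 and 2. Instead of computing moments, the proof writes (P - K) times the density
    as the derivative of Q times the density and applies [integral_flow_derivative] to the
    translations of the line. *)
Lemma integral_normal_quadratic_sqr (a b c : R) :
  (\int[mu]_x (((c + (a * x + b * (x ^+ 2 - 1))) ^+ 2 * nphi x)%:E) =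
   (c ^+ 2 + (a ^+ 2 + 2 * b ^+ 2))%:E)%E.
Proof.
pose K := c ^+ 2 + (a ^+ 2 + 2 * b ^+ 2).
pose P x := (c + (a * x + b * (x ^+ 2 - 1))) ^+ 2.
(* Q solves Q' - x Q = P - K *)
pose Q x := - b ^+ 2 * x ^+ 3 - 2 * a * b * x ^+ 2 - (b ^+ 2 + a ^+ 2 + 2 * b * c) * x
  - 2 * a * (b + c).
have x2 (x : R) : x ^+ 2 <= 1 + x ^+ 4 by nra.
have mid : measurable_fun setT (fun x : R => x) by exact: measurable_id.
have mP : measurable_fun setT P.
  apply: measurable_funX; apply: measurable_funD => //.
  by do ![apply: measurable_funD => //|apply: measurable_funM => //|apply: measurable_funX
    => //].
have mQ : measurable_fun setT Q.
  by do ![apply: measurable_funB => //|apply: measurable_funM => //|apply: measurable_funX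
    => //].
have iP : mu.-integrable setT (fun x => (P x * nphi x)%:E).
  (* From (A + B + C)^2 <= 3 (A^2 + B^2 + C^2) with A = c - b, B = a x, C = b x^2, and 1, x^2, x^4
     <= 1 + x^4. *)
  apply: (@integrable_quartic_normal _ (3 * ((c - b) ^+ 2 + a ^+ 2 + b ^+ 2))) => // x.
  rewrite ger0_norm ?sqr_ge0// /P.
  apply: (@le_trans _ _ (3 * ((c - b) ^+ 2 + (a * x) ^+ 2 + (b * x ^+ 2) ^+ 2))).
    rewrite -subr_ge0.
    rewrite (_ : _ - _ = (c - b - a * x) ^+ 2 + (a * x - b * x ^+ 2) ^+ 2 + (b * x ^+ 2 -
      (c - b)) ^+ 2).
      by rewrite !addr_ge0// sqr_ge0.
    ring.
  rewrite -mulrA ler_pM2l// !mulrDl.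
  have x4 : 0 <= x ^+ 4 by rewrite (exprM x 2 2) sqr_ge0.
  apply: lerD; first apply: lerD.
  - by rewrite ler_peMr ?sqr_ge0// lerDl.
  - by rewrite exprMn ler_wpM2l ?sqr_ge0.
  - by rewrite exprMn -exprM ler_wpM2l ?sqr_ge0// lerDr.
have iphi : mu.-integrable setT (fun x => (nphi x)%:E) by exact: integrable_normal_pdf.
have iQ : mu.-integrable setT (fun x => (Q x * nphi x)%:E).
  pose D := `|b ^+ 2| + `|2 * a * b| + `|b ^+ 2 + a ^+ 2 + 2 * b * c| + `|2 * a * (b + c)|.
  apply: (@integrable_quartic_normal _ D) => // x.
  have x4 : 0 <= x ^+ 4 by rewrite (exprM x 2 2) sqr_ge0.
  have := (sqr_ge0 (x - 1), sqr_ge0 (x + 1), sqr_ge0 (x ^+ 2 - 1),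
    sqr_ge0 (x ^+ 2 - x), sqr_ge0 (x ^+ 2 + x)).
  move=> [[[[h1 h2] h3] h4] h5].
  have nx1 : `|x| <= 1 + x ^+ 4 by rewrite ler_norml; apply/andP; split; lra.
  have nx3 : `|x ^+ 3| <= 1 + x ^+ 4 by rewrite ler_norml; apply/andP; split; lra.
  have nx2 : `|x ^+ 2| <= 1 + x ^+ 4 by rewrite ger0_norm ?sqr_ge0.
  rewrite /Q; apply: le_trans (ler_normB _ _) _.
  rewrite /D [leRHS]mulrDl; apply: lerD; last by rewrite ler_peMr// lerDl.
  apply: le_trans (ler_normB _ _) _; rewrite [leRHS]mulrDl; apply: lerD; last by rewrite
    normrM ler_wpM2l.
  apply: le_trans (ler_normB _ _) _; rewrite [leRHS]mulrDl; apply: lerD; last by rewrite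
    normrM ler_wpM2l.
  by rewrite mulNr normrN normrM ler_wpM2l.
have iK : mu.-integrable setT (fun x => (K * nphi x)%:E).
  by under eq_fun do rewrite EFinM; exact: integrableZl.
have iDH : mu.-integrable setT (EFin \o (fun x => P x * nphi x - K * nphi x)).
  have -> : EFin \o (fun x => P x * nphi x - K * nphi x) =
      ((fun x => (P x * nphi x)%:E) \- (fun x => (K * nphi x)%:E))%E.
    by apply/funext => x /=; rewrite EFinB.
  exact: integrableB.
have := @integral_flow_derivative _ (measurableTypeR R) R mu (fun s x => x + s) _ _ _
  (fun x => Q x * nphi x) (fun x => P x * nphi x - K * nphi x) iQ iDH.
have -> : (\int[mu]_x (P x * nphi x - K * nphi x)%:E =
  \int[mu]_x (P x * nphi x)%:E - K%:E)%E.
  under eq_integral do rewrite EFinB.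
  rewrite (integralB measurableT iP iK); congr (_ - _)%E.
  by under eq_integral do rewrite EFinM; rewrite integralZl// integral_normal_pdf mule1.
move=> H.
have iPfin : (\int[mu]_x (P x * nphi x)%:E)%E \is a fin_num by exact: integrable_fin_num.
suff /eqP : (\int[mu]_x (P x * nphi x)%:E - K%:E = 0)%E.
  by rewrite sube_eq ?add0e// => /eqP.
apply: H.
- by apply: measurable_funD => //.
- by move=> x; rewrite addr0.
- by move=> s f mf f0; exact: ge0_integral_translation.
move=> x s.
have nphiE (y : R) : nphi y = normal_peak 1 * expR (- (y * y / 2)).
  by rewrite normal_pdfE ?oner_neq0// /normal_fun; congr (_ * expR _); field.
apply: (is_derive_translate (f := fun y => Q y * nphi y)); move: (x + s) => y.
have -> : (fun s => Q s * nphi s) = (fun s => (Q s * normal_peak 1) * expR (- (s * s / 2))).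
  by apply/funext => z; rewrite nphiE mulrA.
have de : is_derive y 1 (fun s => expR (- (s * s / 2))) (- y * expR (- (y * y / 2))).
  have d2 : is_derive y 1 (fun s => - (s * s / 2)) (- y).
    by apply: is_derive_eq; rewrite /GRing.scale/= mulr0 mulr0 !mulr1 add0r; lra.
  have := @is_derive1_comp _ expR (fun s => - (s * s / 2)) y _ _ (is_derive_expR _) d2.
  by rewrite mulrC.
rewrite /Q; apply: is_derive_eq.
by rewrite nphiE /GRing.scale/= /P /K; ring.
Qed.

Lemma integral_lebesgue_tuple_prod n (f : 'I_n -> R -> R) (K : 'I_n -> R) :
  (forall j, measurable_fun setT (f j)) -> (forall j x, 0 <= f j x) ->
  (forall j, \int[mu]_x (f j x)%:E = (K j)%:E)%E ->
  (\int[lebesgue_tuple n]_t (\prod_(j < n) f j (tnth t j))%:E = (\prod_(j < n) K j)%:E)%E.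
Proof.
elim: n f K => [|n IH] f K mf f0 fK.
  by rewrite lebesgue_tuple0_integral !big_ord0.
have mprod m (g : 'I_m -> R -> R) : (forall j, measurable_fun setT (g j)) ->
    measurable_fun setT (fun t : m.-tuple R => \prod_(j < m) g j (tnth t j)).
  move=> mg; apply: measurable_prod => j _.
  exact: (measurableT_comp (mg j) (@measurable_tnth _ R m j)).
rewrite ge0_lebesgue_tupleS; last 2 first.
- by apply/measurable_EFinP; exact: mprod.
- by move=> t; rewrite lee_fin prodr_ge0.
transitivity (\int[mu]_x ((f ord0 x)%:E * (\prod_(j < n) K (lift ord0 j))%:E))%E.
  apply: eq_integral => x _.
  under eq_integral do rewrite big_ord_recl tnth0 EFinM.
  rewrite ge0_integralZl//=; last 3 first.
  - apply/measurable_EFinP.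
    apply: (measurable_prod (I := 'I_n)) => j _.
    under eq_fun do rewrite tnthS.
    exact: (measurableT_comp (mf _) (@measurable_tnth _ R n j)).
  - by move=> t _; rewrite lee_fin prodr_ge0.
  - by rewrite lee_fin.
  congr (_ * _)%E; rewrite -(IH (fun j => f (lift ord0 j)))//.
  by apply: eq_integral => t _; congr (_%:E); apply: eq_bigr => j _; rewrite tnthS.
rewrite ge0_integralZr//=; last 3 first.
- by apply/measurable_EFinP; exact: mf.
- by move=> x _; rewrite lee_fin; exact: f0.
- rewrite lee_fin prodr_ge0// => j _; rewrite -lee_fin -fK.
  by apply: integral_ge0 => x _; rewrite lee_fin.
by rewrite fK big_ord_recl EFinM.
Qed.

(** The constant [c] is arbitrary so that, with the first variable frozen, its term can be absorbed
    into [c] and the induction hypothesis applied; the variances then add. *)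
Lemma integral_lebesgue_tuple_normal_quadratic_sqr n (a b : 'I_n -> R) (c : R) :
  (\int[lebesgue_tuple n]_x ((c + \sum_(j < n) (a j * tnth x j + b j * (tnth x j ^+ 2 -
    1))) ^+ 2 *
    \prod_(j < n) nphi (tnth x j))%:E =
   (c ^+ 2 + \sum_(j < n) (a j ^+ 2 + 2 * b j ^+ 2))%:E)%E.
Proof.
elim: n a b c => [|n IH] a b c.
  by rewrite lebesgue_tuple0_integral !big_ord0 !addr0 mulr1.
have mt m (j : 'I_m) : measurable_fun setT (fun x : m.-tuple R => tnth x j).
  exact: measurable_tnth.
have mF m (a' b' : 'I_m -> R) c' : measurable_fun setT (fun x : m.-tuple R =>
   (c' + \sum_(j < m) (a' j * tnth x j + b' j * (tnth x j ^+ 2 - 1))) ^+ 2 *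
    \prod_(j < m) nphi (tnth x j)).
  apply: measurable_funM.
    apply: measurable_funX; apply: measurable_funD => //; apply: measurable_sum => j.
    apply: measurable_funD; apply: measurable_funM => //; first exact: mt.
    by apply: measurable_funB => //; apply: measurable_funX; exact: mt.
  apply: measurable_prod => j _.
  exact: (measurableT_comp (measurable_normal_pdf _ _) (mt _ _)).
rewrite ge0_lebesgue_tupleS; last 2 first.
- by apply/measurable_EFinP; exact: mF.
- by move=> t; rewrite lee_fin mulr_ge0 ?sqr_ge0// prodr_ge0// => j _; exact: normal_pdf_ge0.
pose S := \sum_(j < n) (a (lift ord0 j) ^+ 2 + 2 * b (lift ord0 j) ^+ 2).
pose X x := a ord0 * x + b ord0 * (x ^+ 2 - 1).
transitivity (\int[mu]_x (((c + X x) ^+ 2 * nphi x)%:E + (S%:E * (nphi x)%:E)))%E.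
  apply: eq_integral => x _.
  rewrite -EFinM -EFinD -mulrDl mulrC EFinM -(IH (fun j => a (lift ord0 j)) (fun j => b
    (lift ord0 j))).
  rewrite -ge0_integralZl//=; last 3 first.
  - by apply/measurable_EFinP; exact: mF.
  - by move=> t _; rewrite lee_fin mulr_ge0 ?sqr_ge0// prodr_ge0// => j _; exact:
    normal_pdf_ge0.
  - by rewrite lee_fin normal_pdf_ge0.
  apply: eq_integral => t _; rewrite -EFinM !big_ord_recl tnth0 -/(X x) addrA [in RHS]mulrCA.
  congr (((_ + _) ^+ 2 * (_ * _))%:E); apply: eq_bigr => j _; by rewrite tnthS.
have S0 : 0 <= S.
  by apply: sumr_ge0 => j _; rewrite addr_ge0 ?sqr_ge0// mulr_ge0 ?sqr_ge0.
have mid : measurable_fun setT (fun x : R => x) by exact: measurable_id.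
rewrite ge0_integralD//=; last 4 first.
- by move=> x _; rewrite lee_fin mulr_ge0 ?sqr_ge0 ?normal_pdf_ge0.
- apply/measurable_EFinP; apply: measurable_funM; last exact: measurable_normal_pdf.
  apply: measurable_funX; apply: measurable_funD => //; apply: measurable_funD; apply:
    measurable_funM => //.
  by apply: measurable_funB => //; exact: measurable_funX.
- by move=> x _; rewrite lee_fin mulr_ge0// normal_pdf_ge0.
- apply/measurable_EFinP; apply: measurable_funM => //; exact: measurable_normal_pdf.
rewrite integral_normal_quadratic_sqr.
rewrite integralZl//=; last exact: integrable_normal_pdf.
rewrite integral_normal_pdf mule1 -EFinD big_ord_recl; congr (_%:E); rewrite -/S; ring.
Qed.

End gaussian_moments.

(** * Independent normal observations and their score *)

Section normal_sample.
Context {R : realType}.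
Local Notation mu := (@lebesgue_measure R).
Local Notation nphi := (normal_pdf (0 : R) 1).

Lemma measurable_prod_tnth n (f : 'I_n -> R -> R) :
  (forall j, measurable_fun setT (f j)) ->
  measurable_fun setT (fun t : n.-tuple R => \prod_(j < n) f j (tnth t j)).
Proof.
move=> mf; apply: measurable_prod => j _.
exact: (measurableT_comp (mf j) (@measurable_tnth _ R n j)).
Qed.

(** Passes from the standard noise, over which [Eth] integrates, to the observations and their joint
    density, substituting one coordinate at a time. *)
Lemma ge0_integral_lebesgue_tuple_normal_affine n (m s : 'I_n -> R) (G : n.-tuple R -> \bar R) :
  (forall j, 0 < s j) -> measurable_fun setT G -> (forall y, 0 <= G y)%E ->
  (\int[lebesgue_tuple n]_x (G [tuple (m j + s j * tnth x j)%R | j < n] *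
      (\prod_(j < n) nphi (tnth x j))%:E) =
   \int[lebesgue_tuple n]_y (G y * (\prod_(j < n) normal_pdf (m j) (s j) (tnth y j))%:E))%E.
Proof.
elim: n m s G => [|n IH] m s G s0 mG G0.
  by rewrite !lebesgue_tuple0_integral !big_ord0 (tuple0 (mktuple _)).
have mcons a : measurable_fun setT (fun t : n.-tuple R => G (cons_tuple a t)).
  by apply: (measurableT_comp mG); apply: (@measurable_cons _ _ _ _ (cst a) n id).
have nphi0 k (f : 'I_k -> R) (g : 'I_k -> R) (t : k.-tuple R) :
    (0%:E <= (\prod_(j < k) normal_pdf (f j) (g j) (tnth t j))%:E)%E.
  by rewrite lee_fin; apply: prodr_ge0 => j _; exact: normal_pdf_ge0.
have mnphi k (f : 'I_k -> R) (g : 'I_k -> R) :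
    measurable_fun setT (fun t : k.-tuple R => (\prod_(j < k) normal_pdf (f j) (g j) (tnth
      t j))%:E).
  by apply/measurable_EFinP; apply: (@measurable_prod_tnth k (fun j => normal_pdf (f j) (g
    j))) => j; exact: measurable_normal_pdf.
have maff k (m' s' : 'I_k -> R) :
    measurable_fun setT (fun x : k.-tuple R => [tuple m' j + s' j * tnth x j | j < k]).
  apply/measurable_fun_tnthP => j.
  rewrite (_ : _ \o _ = fun x => m' j + s' j * tnth x j); last first.
    by apply/funext => x /=; rewrite tnth_mktuple.
  by apply: measurable_funD => //; apply: measurable_funM => //; exact: measurable_tnth.
rewrite ge0_lebesgue_tupleS; last 2 first.
- by apply: emeasurable_funM; [exact: (measurableT_comp mG (maff _ _ _))|exact: (mnphi _
  (fun=> 0) (fun=> 1))].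
- by move=> t; apply: mule_ge0 => //; exact: (nphi0 _ (fun=> 0) (fun=> 1)).
rewrite [RHS]ge0_lebesgue_tupleS; last 2 first.
- by apply: emeasurable_funM => //; exact: mnphi.
- by move=> t; apply: mule_ge0 => //; exact: nphi0.
pose m' j := m (lift ord0 j); pose s' j := s (lift ord0 j).
pose Kf b := (\int[lebesgue_tuple n]_y (G (cons_tuple b y) *
  (\prod_(j < n) normal_pdf (m' j) (s' j) (tnth y j))%:E))%E.
have Kf0 b : (0 <= Kf b)%E by apply: integral_ge0 => y _; rewrite mule_ge0.
have mKf : measurable_fun setT Kf.
  apply: (@measurable_fun_fubini_tonelli_F _ _ _ _ _ (lebesgue_tuple n)
    (fun p : (measurableTypeR R * n.-tuple R)%type => (G (cons_pair p) *
     (\prod_(j < n) normal_pdf (m' j) (s' j) (tnth p.2 j))%:E))%E).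
    apply: emeasurable_funM; first exact: (measurableT_comp mG (@measurable_cons_pair R n)).
    exact: (measurableT_comp (mnphi _ _ _) measurable_snd).
  by move=> p; rewrite mule_ge0.
transitivity (\int[mu]_a (Kf (m ord0 + s ord0 * a)%R * (nphi a)%:E))%E.
  apply: eq_integral => a _; rewrite /Kf -(IH m' s' (fun t => G (cons_tuple _ t)))//; last
    first.
    by move=> j; exact: s0.
  rewrite -ge0_integralZr//=; last 3 first.
  - by apply: emeasurable_funM; [exact: (measurableT_comp (mcons _) (maff _ _ _))|exact:
    (mnphi _ (fun=> 0) (fun=> 1))].
  - by move=> t _; apply: mule_ge0 => //; exact: (nphi0 _ (fun=> 0) (fun=> 1)).
  - by rewrite lee_fin normal_pdf_ge0.
  apply: eq_integral => t _; rewrite big_ord_recl tnth0 -muleA -EFinM mulrC.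
  congr (G _ * (_ * _)%:E)%E; last by apply: eq_bigr => j _; rewrite tnthS.
  apply: eq_from_tnth => k; rewrite tnth_mktuple.
  by case: (unliftP ord0 k) => [j ->|->]; rewrite ?tnthS ?tnth0// tnth_mktuple.
rewrite ge0_integral_normal_affine//; apply: eq_integral => b _.
rewrite /Kf -ge0_integralZr//=; last 3 first.
- by apply: emeasurable_funM => //; exact: mnphi.
- by move=> t _; apply: mule_ge0 => //; exact: nphi0.
- by rewrite lee_fin normal_pdf_ge0.
apply: eq_integral => t _; rewrite big_ord_recl tnth0 -muleA -EFinM mulrC.
by congr (G _ * (_ * _)%:E)%E; apply: eq_bigr => j _; rewrite tnthS.
Qed.

(* [dm] and [dv] are the derivatives of the mean [m] and of the variance [s ^+ 2]. *)
Definition normal_score (m s dm dv y : R) : R :=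
  (y - m) * dm / s ^+ 2 + dv / (2 * s ^+ 2) * ((y - m) ^+ 2 / s ^+ 2 - 1).

(** Under y = m + s x the coefficients of x and x^2 - 1 in the score are a = dm / s and b = dv / (2
    s^2); then 2 b^2 = dv^2 / (2 s^4) is the origin of the factor 1/2 in [B]. The constant [c] will
    be the prior score, which does not depend on y. *)
Lemma integral_lebesgue_tuple_normal_score_sqr n (m s dm dv : 'I_n -> R) (c : R) :
  (forall j, 0 < s j) ->
  (\int[lebesgue_tuple n]_y (((c + \sum_(j < n) normal_score (m j) (s j) (dm j) (dv j)
    (tnth y j)) ^+ 2 *
     \prod_(j < n) normal_pdf (m j) (s j) (tnth y j))%:E) =
   (c ^+ 2 + \sum_(j < n) ((dm j / s j) ^+ 2 + 2^-1 * (dv j ^+ 2 / s j ^+ 4)))%:E)%E.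
Proof.
move=> s0.
have mt (j : 'I_n) : measurable_fun setT (fun x : n.-tuple R => tnth x j).
  exact: measurable_tnth.
under eq_integral do rewrite EFinM.
rewrite -(@ge0_integral_lebesgue_tuple_normal_affine n m s
  (fun y => ((c + \sum_(j < n) normal_score (m j) (s j) (dm j) (dv j) (tnth y j)) ^+ 2)%:E))//.
- transitivity (c ^+ 2 + \sum_(j < n) ((dm j / s j) ^+ 2 + 2 * (dv j / (2 * s j ^+ 2)) ^+
  2))%:E.
    rewrite -(integral_lebesgue_tuple_normal_quadratic_sqr (fun j => dm j / s j) (fun j =>
      dv j / (2 * s j ^+ 2))).
    apply: eq_integral => x _; rewrite -EFinM; congr (((_ + _) ^+ 2 * _)%:E).
    apply: eq_bigr => j _; rewrite tnth_mktuple /normal_score.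
    by field; rewrite gt_eqF.
  congr ((_ + _)%:E); apply: eq_bigr => j _; congr (_ + _).
  by field; rewrite gt_eqF.
- apply/measurable_EFinP; apply: measurable_funX; apply: measurable_funD => //.
  apply: measurable_sum => j; apply: measurable_funD; apply: measurable_funM => //.
    by apply: measurable_funM => //; apply: measurable_funB => //; exact: mt.
  apply: measurable_funB => //; apply: measurable_funM => //; apply: measurable_funX.
  by apply: measurable_funB => //; exact: mt.
- by move=> y; rewrite lee_fin sqr_ge0.
Qed.

End normal_sample.

(** * Cauchy-Schwarz inequality with a weight *)

Section weighted_cauchy_schwarz.
Context d (T : measurableType d) (R : realType).
Variable M : {measure set T -> \bar R}.
Variables (X W q : T -> R).
Hypothesis mX : measurable_fun setT X.
Hypothesis mW : measurable_fun setT W.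
Hypothesis mq : measurable_fun setT q.
Hypothesis q0 : forall x, 0 <= q x.
Hypothesis iX : M.-integrable setT (fun x => (X x ^+ 2 * q x)%:E).
Hypothesis iW : M.-integrable setT (fun x => (W x ^+ 2 * q x)%:E).

Lemma integrable_weighted_mul : M.-integrable setT (fun x => (X x * W x * q x)%:E).
Proof.
apply: (@le_integrable _ _ _ M setT measurableT _
  ((fun x => (X x ^+ 2 * q x)%:E) \+ (fun x => (W x ^+ 2 * q x)%:E))%E).
- by apply/measurable_EFinP; apply: measurable_funM => //; exact: measurable_funM.
- move=> x _ /=; rewrite lee_fin -mulrDl.
  have key : `|X x * W x| <= X x ^+ 2 + W x ^+ 2.
    by rewrite ler_norml; apply/andP; split;
      [have := sqr_ge0 (X x + W x) | have := sqr_ge0 (X x - W x)];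
      have := sqr_ge0 (X x); have := sqr_ge0 (W x); lra.
  rewrite normrM (ger0_norm (q0 x)); apply: le_trans (ler_norm _).
  by rewrite ler_wpM2r.
- exact: integrableD.
Qed.

(** The quadratic c |-> A - 2 c L + c^2 K is the integral of (X - c W)^2 q, hence nonnegative. *)
Lemma weighted_cauchy_schwarz (A K L : R) :
  (\int[M]_x (X x ^+ 2 * q x)%:E = A%:E)%E ->
  (\int[M]_x (W x ^+ 2 * q x)%:E = K%:E)%E ->
  (\int[M]_x (X x * W x * q x)%:E = L%:E)%E -> L ^+ 2 <= A * K.
Proof.
move=> EA EK EL.
have pos c : 0 <= A - 2 * c * L + c ^+ 2 * K.
  rewrite -lee_fin EFinD EFinB [X in (_ - X)%E]EFinM [X in (_ + X)%E]EFinM -EA -EK -EL.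
  have i1 : M.-integrable setT (fun x => ((2 * c)%:E * (X x * W x * q x)%:E)%E).
    by apply: integrableZl => //; exact: integrable_weighted_mul.
  have i2 : M.-integrable setT (fun x => ((c ^+ 2)%:E * (W x ^+ 2 * q x)%:E)%E).
    exact: integrableZl.
  rewrite -integralZl//; last exact: integrable_weighted_mul.
  rewrite -integralZl// -integralB// -integralD//; last exact: integrableB.
  apply: integral_ge0 => x _.
  rewrite /= lee_fin.
  rewrite (_ : _ + _ = (X x - c * W x) ^+ 2 * q x); last by ring.
  by rewrite mulr_ge0// sqr_ge0.
have A0 : 0 <= A by have := pos 0; rewrite mulr0 mul0r subr0 expr0n/= mul0r addr0.
have K0 : 0 <= K.
  rewrite -lee_fin -EK; apply: integral_ge0 => x _.
  by rewrite lee_fin mulr_ge0// sqr_ge0.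
have [K00|Kn0] := eqVneq K 0.
  have [->|L0] := eqVneq L 0; first by rewrite expr0n/= mulr_ge0.
  (* With K = 0 the quadratic is affine in c, and this c gives it the value -1. *)
  have := pos ((A + 1) / (2 * L)).
  rewrite K00 mulr0 addr0 (_ : 2 * _ * L = A + 1); last by field.
  lra.
have Kp : 0 < K by rewrite lt_neqAle eq_sym Kn0.
(* L / K is the minimizer of the quadratic. *)
have := pos (L / K).
rewrite (_ : _ + _ = (A * K - L ^+ 2) / K); last by field.
by rewrite pmulr_lge0 ?invr_gt0// subr_ge0.
Qed.

End weighted_cauchy_schwarz.

(** * The van Trees inequality for heteroscedastic normal observations *)

Section van_trees.
Context {R : realType} (n l : nat) (i : 'I_l).
Local Notation mu := (@lebesgue_measure R).
Variables (m s dm dv : 'I_n -> l.-tuple R -> R) (lam dlam : l.-tuple R -> R).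
Variables (phi : 'I_l -> R -> R) (dphi : R -> R) (lamhat : n.-tuple R -> R).
Hypothesis s_gt0 : forall j t, 0 < s j t.
Hypothesis cm : forall j k t, continuous (fun h => m j (tshift k h t)).
Hypothesis cv : forall j k t, continuous (fun h => s j (tshift k h t) ^+ 2).
Hypothesis clam : forall k t, continuous (fun h => lam (tshift k h t)).
Hypothesis is_derive_m : forall j t,
  is_derive (0 : R) 1 (fun h => m j (tshift i h t)) (dm j t).
Hypothesis is_derive_v : forall j t,
  is_derive (0 : R) 1 (fun h => s j (tshift i h t) ^+ 2) (dv j t).
Hypothesis is_derive_lam : forall t,
  is_derive (0 : R) 1 (fun h => lam (tshift i h t)) (dlam t).
Hypothesis mphi : forall k, measurable_fun setT (phi k).
Hypothesis mdphi : measurable_fun setT dphi.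
Hypothesis phi_ge0 : forall k z, 0 <= phi k z.
Hypothesis phi1 : forall k, (\int[mu]_z (phi k z)%:E = 1)%E.
Hypothesis is_derive_phi : forall z : R, is_derive z 1 (phi i) (dphi z).
Hypothesis mlamhat : measurable_fun setT lamhat.

Let M := sfprod (@lebesgue_tuple R l) (@lebesgue_tuple R n).
Local Notation TT := (l.-tuple R * n.-tuple R)%type.

Definition prior (t : l.-tuple R) : R := \prod_(k < l) phi k (tnth t k).
Definition likelihood (t : l.-tuple R) (y : n.-tuple R) : R :=
  \prod_(j < n) normal_pdf (m j t) (s j t) (tnth y j).
Let q (p : TT) : R := prior p.1 * likelihood p.1 p.2.
Let score (t : l.-tuple R) (y : n.-tuple R) : R :=
  \sum_(j < n) normal_score (m j t) (s j t) (dm j t) (dv j t) (tnth y j).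
Let W (p : TT) : R := dphi (tnth p.1 i) / phi i (tnth p.1 i) + score p.1 p.2.
Let X (p : TT) : R := lamhat p.2 - lam p.1.

Let ms2 j : measurable_fun setT (fun t => s j t ^+ 2).
Proof. exact: measurable_separately_continuous. Qed.

Let mm j : measurable_fun setT (m j).
Proof. exact: measurable_separately_continuous. Qed.

Let mlam : measurable_fun setT lam.
Proof. exact: measurable_separately_continuous. Qed.

Let mdm j : measurable_fun setT (dm j).
Proof. exact: measurable_partial_derivative (is_derive_m j). Qed.

Let mdv j : measurable_fun setT (dv j).
Proof. exact: (measurable_partial_derivative (ms2 j) (is_derive_v j)). Qed.

Let mdlam : measurable_fun setT dlam.
Proof. exact: measurable_partial_derivative is_derive_lam. Qed.

Let mprior : measurable_fun setT prior.
Proof. exact: measurable_prod_tnth. Qed.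

Let prior_ge0 t : 0 <= prior t. Proof. exact: prodr_ge0. Qed.

Let likelihood_ge0 t y : 0 <= likelihood t y.
Proof. by apply: prodr_ge0 => j _; exact: normal_pdf_ge0. Qed.

Let q_ge0 p : 0 <= q p. Proof. exact: mulr_ge0. Qed.

(** The exponential form reduces both the measurability and the differentiation of the likelihood to
    those of a finite sum. *)
Let likelihoodE t y : likelihood t y =
  expR (\sum_(j < n) normal_logd (m j t) (s j t ^+ 2) (tnth y j)).
Proof.
by rewrite expR_sum; apply: eq_bigr => j _; rewrite normal_pdf_expR.
Qed.

Let mty (j : 'I_n) : measurable_fun setT (fun p : TT => tnth p.2 j).
Proof. exact: (measurableT_comp (@measurable_tnth _ R n j) measurable_snd). Qed.

Let mfst1 (f : l.-tuple R -> R) : measurable_fun setT f ->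
  measurable_fun setT (fun p : TT => f p.1).
Proof. by move=> mf; exact: (measurableT_comp mf measurable_fst). Qed.

Let minv d (T : measurableType d) (f : T -> R) : (forall x, 0 <= f x) ->
  measurable_fun setT f -> measurable_fun setT (fun x => (f x)^-1).
Proof.
move=> f0 mf; under eq_fun do rewrite -powR_inv1//.
exact: (measurableT_comp (@measurable_powR R (-1)) mf).
Qed.

Let mlikelihood : measurable_fun setT (fun p : TT => likelihood p.1 p.2).
Proof.
under eq_fun do rewrite likelihoodE.
apply: (measurableT_comp (@measurable_expR R)); apply: measurable_sum => j.
apply: measurable_funB.
  apply: measurableT_comp => //; apply: measurable_funM => //.
  apply: (measurableT_comp (@measurable_ln R)).
  under eq_fun do rewrite -mulr_natr.
  by do 2 apply: measurable_funM => //; exact: (mfst1 (ms2 j)).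
apply: measurable_funM.
  apply: measurable_funX; apply: measurable_funB; first exact: mty.
  exact: (mfst1 (mm j)).
apply: minv; first by move=> p; rewrite mulrn_wge0// sqr_ge0.
under eq_fun do rewrite -mulr_natr.
by apply: measurable_funM => //; exact: (mfst1 (ms2 j)).
Qed.

Let mq : measurable_fun setT q.
Proof. by apply: measurable_funM => //; exact: (mfst1 mprior). Qed.

Let mW : measurable_fun setT W.
Proof.
apply: measurable_funD.
  apply: (mfst1 (f := fun t => dphi (tnth t i) / phi i (tnth t i))).
  apply: measurable_funM.
    exact: (measurableT_comp mdphi (@measurable_tnth _ R l i)).
  by apply: minv => //; exact: (measurableT_comp (mphi i) (@measurable_tnth _ R l i)).
apply: measurable_sum => j.
have mym : measurable_fun setT (fun p : TT => tnth p.2 j - m j p.1).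
  by apply: measurable_funB; [exact: mty|exact: (mfst1 (mm j))].
have mis : measurable_fun setT (fun p : TT => (s j p.1 ^+ 2)^-1).
  by apply: minv; [move=> p; exact: sqr_ge0|exact: (mfst1 (ms2 j))].
apply: measurable_funD.
  apply: measurable_funM => //; apply: measurable_funM => //; exact: (mfst1 (mdm j)).
apply: measurable_funM.
  apply: measurable_funM; first exact: (mfst1 (mdv j)).
  apply: minv; first by move=> p; rewrite mulr_ge0// sqr_ge0.
  by apply: measurable_funM => //; exact: (mfst1 (ms2 j)).
apply: measurable_funB => //; apply: measurable_funM => //; exact: measurable_funX.
Qed.

Let mX : measurable_fun setT X.
Proof.
apply: measurable_funB; last exact: (mfst1 mlam).
exact: (measurableT_comp mlamhat measurable_snd).
Qed.

(** A zero of the nonnegative [phi i] is a minimum. Hence (dphi / phi) phi = dphi holds everywhere,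
    with the convention x / 0 = 0. *)
Let dphi_eq0 z : phi i z = 0 -> dphi z = 0.
Proof.
move=> pz.
have zab : z \in `]z - 1, (z + 1)%R[ by rewrite in_itv/=; apply/andP; split; lra.
have d0 : is_derive z 1 (phi i) 0.
  apply: (derive1_at_min (a := z - 1) (b := z + 1)) => //.
  - lra.
  - by move=> x _; rewrite pz; exact: phi_ge0.
by have [_ <-] := is_derive_phi z; have [_ ->] := d0.
Qed.

Let is_derive_prior t : is_derive (0 : R) 1 (fun h => prior (tshift i h t))
  (dphi (tnth t i) / phi i (tnth t i) * prior t).
Proof.
pose c := \prod_(k < l | k != i) phi k (tnth t k).
have priorE h : prior (tshift i h t) = phi i (tnth t i + h) * c.
  rewrite /prior (bigD1 i)//= tnth_tshift eqxx mul1r; congr (_ * _).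
  by apply: eq_bigr => k ki; rewrite tnth_tshift (negbTE ki) mul0r addr0.
have -> : prior t = phi i (tnth t i) * c by rewrite -[t](tshift0 i) priorE tnth_tshift
  mulr0 !addr0.
under eq_fun do rewrite priorE.
have d1 : is_derive (0 : R) 1 (fun h => phi i (tnth t i + h)) (dphi (tnth t i)).
  by apply: is_derive_translate; rewrite addr0.
apply: is_derive_eq; rewrite /GRing.scale/= mulr0 add0r mulrA mulrC.
have [p0|p0] := eqVneq (phi i (tnth t i)) 0; last by rewrite divfK.
by rewrite dphi_eq0// p0 !mulr0.
Qed.

(** With v the variance, the contributions of ln v and of 1 / v in the exponent combine into the
    factor (y - m)^2 / v - 1 of [normal_score]. *)
Let is_derive_likelihood t y :
  is_derive (0 : R) 1 (fun h => likelihood (tshift i h t) y) (score t y * likelihood t y).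
Proof.
have logd j : is_derive (0 : R) 1
    (fun h => normal_logd (m j (tshift i h t)) (s j (tshift i h t) ^+ 2) (tnth y j))
    (normal_score (m j t) (s j t) (dm j t) (dv j t) (tnth y j)).
  have dmj := is_derive_m j t; have dvj := is_derive_v j t.
  have v0 : 0 < s j t ^+ 2 by rewrite exprn_gt0.
  have vp0 : 0 < s j t ^+ 2 * pi *+ 2 by rewrite mulrn_wgt0// mulr_gt0 ?pi_gt0.
  have dln : is_derive (0 : R) 1 (fun h => ln (s j (tshift i h t) ^+ 2 * pi *+ 2))
      (dv j t / s j t ^+ 2).
    have dvp : is_derive (0 : R) 1 (fun h => s j (tshift i h t) ^+ 2 * pi *+ 2)
        (dv j t * pi *+ 2).
      under eq_fun do rewrite -mulr_natr.
      by apply: is_derive_eq; rewrite /GRing.scale/= -mulr_natr; ring.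
    have := @is_derive1_comp _ (@ln R) (fun h => s j (tshift i h t) ^+ 2 * pi *+ 2)
      0 _ _ _ dvp.
    rewrite tshift0 => /(_ _ (is_derive1_ln vp0)) dl; apply: (is_derive_eq dl).
    have : (pi : R) != 0 by rewrite gt_eqF ?pi_gt0.
    by move: (pi : R) => P P0; field; rewrite P0 gt_eqF.
  have dinv : is_derive (0 : R) 1 (fun h => (s j (tshift i h t) ^+ 2 *+ 2)^-1)
      (- (dv j t / (s j t ^+ 4 *+ 2))).
    have dv2 : is_derive (0 : R) 1 (fun h => s j (tshift i h t) ^+ 2 *+ 2) (dv j t *+ 2).
      under eq_fun do rewrite -mulr_natr.
      by apply: is_derive_eq; rewrite /GRing.scale/= -mulr_natr; ring.
    have nz : s j (tshift i 0 t) ^+ 2 *+ 2 != 0 by rewrite tshift0 gt_eqF// mulrn_wgt0.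
    have -> : - (dv j t / (s j t ^+ 4 *+ 2)) =
        - (s j (tshift i 0 t) ^+ 2 *+ 2) ^- 2 *: (dv j t *+ 2).
      by rewrite /GRing.scale/= tshift0; field; rewrite gt_eqF.
    exact: is_deriveV.
  rewrite /normal_logd; apply: is_derive_eq.
  rewrite /GRing.scale/= tshift0 /normal_score.
  by field; rewrite gt_eqF.
under eq_fun do rewrite likelihoodE.
have dsum : is_derive (0 : R) 1 (fun h =>
   \sum_(j < n) normal_logd (m j (tshift i h t)) (s j (tshift i h t) ^+ 2) (tnth y j))
   (score t y).
  have := @is_derive_sum R R R n (fun j h => normal_logd (m j (tshift i h t)) (s j (tshift
    i h t) ^+ 2) (tnth y j)) 0 1 _ logd.
  rewrite /score; congr (is_derive _ _ _ _).
  by apply/funext => h; rewrite fct_sumE.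
have := @is_derive1_comp _ expR _ 0 _ _ (is_derive_expR _) dsum.
by rewrite -likelihoodE tshift0 mulrC.
Qed.

Let flow (h : R) (p : TT) : TT := (tshift i h p.1, p.2).

Let mflow : measurable_fun setT (fun p : (measurableTypeR R * TT)%type => flow p.1 p.2).
Proof.
apply: measurable_fun_pair.
  apply: (measurableT_comp (measurable_tshift i) (g := fun p : (measurableTypeR R *
    TT)%type => (p.1, p.2.1) : (measurableTypeR R * l.-tuple R)%type)).
  apply: measurable_fun_pair => //.
  exact: (measurableT_comp measurable_fst measurable_snd).
exact: (measurableT_comp measurable_snd measurable_snd).
Qed.

Let flow_invariant h (f : TT -> \bar R) : measurable_fun setT f ->
  (forall x, 0 <= f x)%E -> (\int[M]_x f (flow h x) = \int[M]_x f x)%E.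
Proof.
move=> mf f0.
have mfh : measurable_fun setT (fun p => f (flow h p)).
  apply: (measurableT_comp mf).
  exact: (measurableT_comp mflow (measurable_fun_pair (measurable_cst h) (@measurable_id _
    _ _))).
(* Tonelli with y outermost, so that the shift of t acts on the inner integral alone. *)
rewrite [LHS](fubini_tonelli2 (fun p => f (flow h p)))//.
rewrite [RHS](fubini_tonelli2 f)//; apply: eq_integral => y _.
apply: (ge0_integral_tshift i h (f := fun t => f (t, y))) => //.
exact: (measurableT_comp mf (measurable_fun_pair (@measurable_id _ _ _) (measurable_cst y))).
Qed.

Let is_derive_flow p (h : R) : is_derive h 1 (fun h => X (flow h p) * q (flow h p))
  (X (flow h p) * W (flow h p) * q (flow h p) - dlam (flow h p).1 * q (flow h p)).
Proof.
have at0 t y : is_derive (0 : R) 1 (fun h => X (tshift i h t, y) * q (tshift i h t, y))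
    (X (t, y) * W (t, y) * q (t, y) - dlam t * q (t, y)).
  rewrite /X /W /q/=.
  have dlam0 := is_derive_lam t.
  have dp := is_derive_prior t.
  have dl := is_derive_likelihood t y.
  apply: is_derive_eq; rewrite /GRing.scale/= tshift0.
  ring.
(* The group law of the shifts carries the derivative at 0, known at all base points, to every h. *)
case: p => t y; apply/is_derive_quotientP => e e0.
have /is_derive_quotientP/(_ _ e0)[d d0 dH] := at0 (tshift i h t) y.
exists d => // x x0 xd; have := dH x x0 xd.
by rewrite /= addr0 tshift0 -tshiftD.
Qed.

Let integral_M (f : TT -> \bar R) : measurable_fun setT f -> (forall x, 0 <= f x)%E ->
  (\int[M]_p f p = \int[lebesgue_tuple l]_t \int[lebesgue_tuple n]_y f (t, y))%E.
Proof. by move=> mf f0; exact: fubini_tonelli1. Qed.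

Let integral_likelihood t : (\int[lebesgue_tuple n]_y (likelihood t y)%:E = 1)%E.
Proof.
rewrite /likelihood (@integral_lebesgue_tuple_prod _ n (fun j => normal_pdf (m j t) (s j
  t)) (fun=> 1)).
- by rewrite big1.
- by move=> j; exact: measurable_normal_pdf.
- by move=> j x; exact: normal_pdf_ge0.
- by move=> j; exact: integral_normal_pdf.
Qed.

Let mlikelihood2 t : measurable_fun setT (likelihood t).
Proof.
exact: (measurableT_comp mlikelihood (measurable_fun_pair (measurable_cst t)
  (@measurable_id _ _ _))).
Qed.

Let integral_Mq (f : l.-tuple R -> R) : measurable_fun setT f -> (forall t, 0 <= f t) ->
  (\int[M]_p (f p.1 * q p)%:E = \int[lebesgue_tuple l]_t (f t * prior t)%:E)%E.
Proof.
move=> mf f0; rewrite integral_M; last 2 first.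
- by apply/measurable_EFinP; apply: measurable_funM => //; exact: (mfst1 mf).
- by move=> p; rewrite lee_fin mulr_ge0.
apply: eq_integral => t _; rewrite /q/=.
under eq_integral do rewrite mulrA EFinM.
rewrite ge0_integralZl//=; first by rewrite integral_likelihood mule1.
- exact/measurable_EFinP.
- by move=> y _; rewrite lee_fin.
- by rewrite lee_fin mulr_ge0.
Qed.

Let F := (\int[lebesgue_tuple l]_t ((\sum_(j < n) (dm j t / s j t) ^+ 2) * prior t)%:E)%E.
Let B := (\int[lebesgue_tuple l]_t
  (2^-1 * (\sum_(j < n) (dv j t ^+ 2 / s j t ^+ 4)) * prior t)%:E)%E.
Let I := (\int[mu]_z (dphi z ^+ 2 / phi i z)%:E)%E.
Let Lam := (\int[lebesgue_tuple l]_t (dlam t * prior t)%:E)%E.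
Hypothesis Ifin : (I < +oo)%E.
Hypothesis ilam_iint : (iint (fun t : l.-tuple R => (`|dlam t| * prior t)%:E) < +oo)%E.

Let ilam : (\int[lebesgue_tuple l]_t (`|dlam t| * prior t)%:E < +oo)%E.
Proof.
rewrite -ge0_iintE//; last by move=> t; rewrite lee_fin mulr_ge0.
apply/measurable_EFinP; apply: measurable_funM => //; exact: measurableT_comp.
Qed.


Let F_ge0 : (0 <= F)%E.
Proof.
apply: integral_ge0 => t _; rewrite lee_fin mulr_ge0//.
by apply: sumr_ge0 => j _; exact: sqr_ge0.
Qed.

Let mF : measurable_fun setT (fun t => \sum_(j < n) (dm j t / s j t) ^+ 2).
Proof.
apply: measurable_sum => j.
under eq_fun do rewrite exprMn exprVn.
apply: measurable_funM; first exact: measurable_funX.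
by apply: minv => // t; exact: sqr_ge0.
Qed.

Let mB : measurable_fun setT (fun t => 2^-1 * \sum_(j < n) (dv j t ^+ 2 / s j t ^+ 4)).
Proof.
apply: measurable_funM => //; apply: measurable_sum => j.
apply: measurable_funM; first exact: measurable_funX.
apply: minv; first by move=> t; rewrite exprn_ge0// ltW.
by under eq_fun do rewrite (exprM _ 2 2); exact: measurable_funX.
Qed.

Let B_integrand_ge0 t : 0 <= 2^-1 * \sum_(j < n) (dv j t ^+ 2 / s j t ^+ 4).
Proof.
rewrite mulr_ge0//; apply: sumr_ge0 => j _.
by rewrite divr_ge0 ?sqr_ge0// exprn_ge0// ltW.
Qed.

Let B_ge0 : (0 <= B)%E.
Proof. by apply: integral_ge0 => t _; rewrite lee_fin mulr_ge0. Qed.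

Let I_ge0 : (0 <= I)%E.
Proof. by apply: integral_ge0 => z _; rewrite lee_fin divr_ge0 ?sqr_ge0. Qed.

Let integral_prior : (\int[lebesgue_tuple l]_t (prior t)%:E = 1)%E.
Proof.
by rewrite /prior (@integral_lebesgue_tuple_prod _ l phi (fun=> 1))// big1.
Qed.

Let minfo : measurable_fun setT (fun z => dphi z ^+ 2 / phi i z).
Proof.
by apply: measurable_funM; [exact: measurable_funX|exact: minv].
Qed.

Let rho (t : l.-tuple R) := dphi (tnth t i) / phi i (tnth t i).

Let mrho : measurable_fun setT rho.
Proof.
apply: measurable_funM.
  exact: (measurableT_comp mdphi (@measurable_tnth _ R l i)).
by apply: minv => //; exact: (measurableT_comp (mphi i) (@measurable_tnth _ R l i)).
Qed.

(** The integrand factorizes: its i-th factor rho^2 phi_i equals phi_i'^2 / phi_i, also at zeros of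
    phi_i, where both are 0; every other factor integrates to 1. *)
Let integral_prior_info : (\int[lebesgue_tuple l]_t (rho t ^+ 2 * prior t)%:E = I)%E.
Proof.
have Ifn : I \is a fin_num by rewrite ge0_fin_numE.
pose f (k : 'I_l) := if k == i then (fun z => dphi z ^+ 2 / phi i z) else phi k.
pose K (k : 'I_l) := if k == i then fine I else 1.
transitivity (\int[lebesgue_tuple l]_t (\prod_(k < l) f k (tnth t k))%:E)%E.
  apply: eq_integral => t _; congr (_%:E); rewrite /prior (bigD1 i)//= [RHS](bigD1 i)//=.
  rewrite mulrA; congr (_ * _).
    rewrite /f eqxx /rho; have [p0|p0] := eqVneq (phi i (tnth t i)) 0.
      by rewrite p0 invr0 !mulr0.
    by field.
  by apply: eq_bigr => k ki; rewrite /f (negbTE ki).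
rewrite (@integral_lebesgue_tuple_prod _ l f K).
- rewrite (bigD1 i)//= /K eqxx big1 ?mulr1 ?fineK// => k ki.
  by rewrite (negbTE ki).
- by move=> k; rewrite /f; case: ifP.
- by move=> k z; rewrite /f; case: ifP => // _; rewrite divr_ge0 ?sqr_ge0.
- by move=> k; rewrite /f /K; case: ifP => // _; rewrite fineK.
Qed.

(** For fixed t the prior score is a constant in y and the score of the observations is centred, so
    no cross term appears: the inner integral is prior t times the sum of rho^2 and the variance of
    the score. *)
Let integral_Wq : (\int[M]_p (W p ^+ 2 * q p)%:E = F + B + I)%E.
Proof.
rewrite integral_M; last 2 first.
- by apply/measurable_EFinP; apply: measurable_funM => //; exact: measurable_funX.
- by move=> p; rewrite lee_fin mulr_ge0 ?sqr_ge0.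
have mpr (f : l.-tuple R -> R) : measurable_fun setT f ->
    measurable_fun setT (fun t => (f t * prior t)%:E).
  by move=> mf; apply/measurable_EFinP; exact: measurable_funM.
have r2p0 t : (0 <= (rho t ^+ 2 * prior t)%:E)%E by rewrite lee_fin mulr_ge0 ?sqr_ge0.
have fp0 t : (0 <= ((\sum_(j < n) (dm j t / s j t) ^+ 2) * prior t)%:E)%E.
  by rewrite lee_fin mulr_ge0//; apply: sumr_ge0 => j _; exact: sqr_ge0.
have bp0 t : (0 <= (2^-1 * (\sum_(j < n) (dv j t ^+ 2 / s j t ^+ 4)) * prior t)%:E)%E.
  by rewrite lee_fin mulr_ge0.
rewrite -integral_prior_info /F /B -ge0_integralD//; last 2 first.
- exact: mpr.
- exact: mpr.
rewrite -ge0_integralD//; last 3 first.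
- by move=> t _; exact: adde_ge0.
- by apply: emeasurable_funD; exact: mpr.
- by apply: mpr; exact: measurable_funX.
apply: eq_integral => t _.
transitivity ((prior t)%:E * \int[lebesgue_tuple n]_y ((rho t + score t y) ^+ 2 *
  likelihood t y)%:E)%E.
  rewrite -ge0_integralZl//=; last 3 first.
  - apply: (measurableT_comp (f := fun p : TT => (W p ^+ 2 * likelihood p.1 p.2)%:E)
      _ (measurable_fun_pair (measurable_cst t) (@measurable_id _ _ _))).
    by apply/measurable_EFinP; apply: measurable_funM => //; exact: measurable_funX.
  - by move=> y _; rewrite lee_fin mulr_ge0 ?sqr_ge0.
  - by rewrite lee_fin.
  by apply: eq_integral => y _; rewrite -EFinM /W /q/= mulrCA.
rewrite /score /likelihood integral_lebesgue_tuple_normal_score_sqr; last by move=> j;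
  exact: s_gt0.
rewrite -EFinM -!EFinD; congr (_%:E).
rewrite big_split/= -mulr_sumr -!mulrDl [RHS]mulrC; congr (_ * _).
exact: addrC.
Qed.

Let van_trees_M :
  (Lam * Lam / (F + B + I) <= \int[M]_p ((lamhat p.2 - lam p.1) ^+ 2 * q p)%:E)%E.
Proof.
have A0 : (0 <= \int[M]_p (X p ^+ 2 * q p)%:E)%E.
  by apply: integral_ge0 => p _; rewrite lee_fin mulr_ge0 ?sqr_ge0.
have K0 : (0 <= F + B + I)%E by exact: (adde_ge0 (adde_ge0 F_ge0 B_ge0) I_ge0).
(* An infinite risk is trivial, and an infinite information makes the left side 0 because the
   inverse of [+oo] is 0. In the remaining case X and W are square integrable with weight q. *)
have [Aoo|Afin] := eqVneq (\int[M]_p (X p ^+ 2 * q p)%:E)%E +oo%E.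
  by rewrite Aoo leey.
have [Koo|Kfin] := eqVneq (F + B + I)%E +oo%E.
  by rewrite Koo invey mule0.
have mX2q : measurable_fun setT (fun p => (X p ^+ 2 * q p)%:E).
  by apply/measurable_EFinP; apply: measurable_funM => //; exact: measurable_funX.
have mW2q : measurable_fun setT (fun p => (W p ^+ 2 * q p)%:E).
  by apply/measurable_EFinP; apply: measurable_funM => //; exact: measurable_funX.
have ge0_integrable (f : TT -> R) : measurable_fun setT (fun p => (f p)%:E) ->
    (forall p, 0 <= f p) -> (\int[M]_p (f p)%:E < +oo)%E -> M.-integrable setT (fun p => (f
      p)%:E).
  move=> mf f0 fi; apply/integrableP; split => //.
  by under eq_integral do rewrite gee0_abs ?lee_fin//.
have iX : M.-integrable setT (fun p => (X p ^+ 2 * q p)%:E).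
  apply: ge0_integrable => //; last by rewrite ltey.
  by move=> p; rewrite mulr_ge0 ?sqr_ge0.
have iW : M.-integrable setT (fun p => (W p ^+ 2 * q p)%:E).
  apply: ge0_integrable => //; last by rewrite integral_Wq ltey.
  by move=> p; rewrite mulr_ge0 ?sqr_ge0.
have iq : M.-integrable setT (fun p => (q p)%:E).
  apply: ge0_integrable => //; first exact/measurable_EFinP.
  have := @integral_Mq (fun=> 1) (measurable_cst _) (fun=> ler01).
  under eq_integral do rewrite mul1r.
  by move=> ->; under eq_integral do rewrite mul1r; rewrite integral_prior ltry.
have iXWq : M.-integrable setT (fun p => (X p * W p * q p)%:E).
  exact: integrable_weighted_mul.
(* |X| <= X^2 + 1, and q has total mass 1. *)
have iH : M.-integrable setT (fun p => (X p * q p)%:E).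
  apply: (@le_integrable _ _ _ M setT measurableT _
    ((fun p => (X p ^+ 2 * q p)%:E) \+ (fun p => (q p)%:E))%E).
  - by apply/measurable_EFinP; exact: measurable_funM.
  - move=> p _ /=; rewrite lee_fin normrM (ger0_norm (q_ge0 p)).
    apply: le_trans (ler_norm _); rewrite -[X in _ <= _ + X]mul1r -mulrDl ler_wpM2r//.
    by rewrite ler_norml; have := sqr_ge0 (X p - 1); have := sqr_ge0 (X p + 1);
      have := sqr_ge0 (X p) => h1 h2 h3; apply/andP; split; lra.
  - exact: integrableD.
have idlam : M.-integrable setT (fun p => (dlam p.1 * q p)%:E).
  apply/integrableP; split.
    by apply/measurable_EFinP; apply: measurable_funM => //; exact: (mfst1 mdlam).
  under eq_integral do rewrite /= normrM (ger0_norm (q_ge0 _)).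
  by rewrite (integral_Mq (f := fun t => `|dlam t|))//; exact: measurableT_comp.
have LamE : (\int[M]_p (dlam p.1 * q p)%:E = Lam)%E.
  rewrite -[LHS](integral12_prod_meas1 idlam); apply: eq_integral => t _.
  rewrite /fubini_F /q/=; under eq_integral do rewrite mulrA EFinM.
  rewrite integralZl ?integral_likelihood ?mule1//.
  apply/integrableP; split; first exact/measurable_EFinP.
  by under eq_integral do rewrite /= ger0_norm//; rewrite integral_likelihood ltry.
have iDH : M.-integrable setT (EFin \o (fun p => X p * W p * q p - dlam p.1 * q p)).
  have -> : EFin \o (fun p => X p * W p * q p - dlam p.1 * q p) =
      ((fun p => (X p * W p * q p)%:E) \- (fun p => (dlam p.1 * q p)%:E))%E.
    by apply/funext => p /=; rewrite EFinB.
  exact: integrableB.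
have flow0 p : flow 0 p = p by case: p => t y; rewrite /flow tshift0.
have := integral_flow_derivative mflow flow0 flow_invariant iH iDH is_derive_flow.
under eq_integral do rewrite EFinB.
rewrite (integralB measurableT iXWq idlam) LamE => /eqP.
have Lfin : Lam \is a fin_num by rewrite -LamE integrable_fin_num.
rewrite sube_eq ?add0e//; last by rewrite integrable_fin_num.
move=> /eqP XWE.
have Kfn : (F + B + I)%E \is a fin_num by rewrite ge0_fin_numE// ltey.
have Afn : (\int[M]_p (X p ^+ 2 * q p)%:E)%E \is a fin_num by rewrite ge0_fin_numE// ltey.
have := @weighted_cauchy_schwarz _ _ _ M X W q mX mW mq q_ge0 iX iW
  (fine (\int[M]_p (X p ^+ 2 * q p)%:E)%E) (fine (F + B + I)) (fine Lam).
rewrite !fineK// => /(_ erefl integral_Wq XWE).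
rewrite -[X in (_ <= X)%E](fineK Afn) -(fineK Kfn) -(fineK Lfin).
set A := fine (\int[M]_p (X p ^+ 2 * q p)%:E)%E; set L' := fine Lam; set K := fine (F + B +
  I)%E.
move=> LAK; have A0' : 0 <= A by apply: fine_ge0.
have K0' : 0 <= K by apply: fine_ge0.
(* The inverse of 0 is [+oo] here; but K = 0 forces L'^2 <= A K = 0, so the left side is 0 times
   [+oo], that is 0. *)
rewrite inver; case: eqVneq => [K00|Kn0].
  move: LAK; rewrite K00 mulr0 => L20.
  have -> : L' = 0 by apply/eqP; rewrite -sqrf_eq0 eq_le L20 sqr_ge0.
  by rewrite mule0 mul0e lee_fin.
rewrite -!EFinM lee_fin ler_pdivrMr; first by rewrite -expr2.
by rewrite lt_neqAle eq_sym Kn0.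
Qed.

Let iint_Lam : iint (fun t : l.-tuple R => (dlam t * prior t)%:E) = Lam.
Proof.
apply: iintE; apply/integrableP; split.
  by apply/measurable_EFinP; exact: measurable_funM.
by under eq_integral do rewrite /= normrM (ger0_norm (prior_ge0 _)).
Qed.

(** The prior stands under the sum, here and in [iint_B], because the scope of [\sum] includes it in
    the [F] and [B] of the final statement. *)
Let iint_F : iint (fun t : l.-tuple R =>
  (\sum_(j < n) ((dm j t / s j t) ^+ 2 * prior t))%:E) = F.
Proof.
rewrite ge0_iintE.
- by apply: eq_integral => t _; rewrite mulr_suml.
- by apply/measurable_EFinP; under eq_fun do rewrite -mulr_suml; exact: measurable_funM.
- by move=> t; rewrite lee_fin; apply: sumr_ge0 => j _; rewrite mulr_ge0 ?sqr_ge0.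
Qed.

Let iint_B : iint (fun t : l.-tuple R =>
  (2^-1 * \sum_(j < n) (dv j t ^+ 2 / s j t ^+ 4 * prior t))%:E) = B.
Proof.
rewrite ge0_iintE.
- by apply: eq_integral => t _; rewrite -mulr_suml mulrA.
- apply/measurable_EFinP; under eq_fun do rewrite -mulr_suml mulrA.
  exact: measurable_funM.
- by move=> t; rewrite lee_fin -mulr_suml mulrA mulr_ge0.
Qed.

(** For each t the noise is replaced by the observations, and Tonelli then merges the two iterated
    integrals into one against the joint density. *)
Let iint_risk : iint (fun t : l.-tuple R =>
    (iint (fun x : n.-tuple R =>
       ((lamhat [tuple (m j t + s j t * tnth x j)%R | j < n] - lam t) ^+ 2 *
        \prod_(j < n) normal_pdf 0 1 (tnth x j))%:E) * (prior t)%:E)%E) =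
  (\int[M]_p (X p ^+ 2 * q p)%:E)%E.
Proof.
pose G t (y : n.-tuple R) := ((lamhat y - lam t) ^+ 2)%:E.
have mG t : measurable_fun setT (G t).
  by apply/measurable_EFinP; apply: measurable_funX; exact: measurable_funB.
have innerE t : iint (fun x : n.-tuple R =>
       ((lamhat [tuple (m j t + s j t * tnth x j)%R | j < n] - lam t) ^+ 2 *
        \prod_(j < n) normal_pdf 0 1 (tnth x j))%:E) =
    (\int[lebesgue_tuple n]_y ((lamhat y - lam t) ^+ 2 * likelihood t y)%:E)%E.
  rewrite ge0_iintE.
  - under eq_integral do rewrite EFinM.
    rewrite (@ge0_integral_lebesgue_tuple_normal_affine _ n (m ^~ t) (s ^~ t) (G t))//.
    by move=> y; rewrite lee_fin sqr_ge0.
  - apply/measurable_EFinP; apply: measurable_funM; last first.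
      by apply: (@measurable_prod_tnth _ n (fun=> normal_pdf 0 1)) => j; exact:
        measurable_normal_pdf.
    apply: measurable_funX; apply: measurable_funB => //.
    apply: (measurableT_comp mlamhat); apply/measurable_fun_tnthP => j.
    rewrite (_ : _ \o _ = fun x => m j t + s j t * tnth x j); last first.
      by apply/funext => x /=; rewrite tnth_mktuple.
    by apply: measurable_funD => //; apply: measurable_funM => //; exact: measurable_tnth.
  - move=> x; rewrite lee_fin mulr_ge0 ?sqr_ge0//; apply: prodr_ge0 => j _; exact:
    normal_pdf_ge0.
under eq_fun do rewrite innerE.
have mXl : measurable_fun setT (fun p : TT => ((lamhat p.2 - lam p.1) ^+ 2 * likelihood p.1
  p.2)%:E).
  by apply/measurable_EFinP; apply: measurable_funM => //; exact: (measurable_funX _ mX).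
have Xl0 (p : TT) : (0 <= ((lamhat p.2 - lam p.1) ^+ 2 * likelihood p.1 p.2)%:E)%E.
  by rewrite lee_fin mulr_ge0 ?sqr_ge0.
rewrite ge0_iintE; last 2 first.
- apply: emeasurable_funM; last exact/measurable_EFinP.
  exact: (measurable_fun_fubini_tonelli_F _ mXl Xl0).
- by move=> t; rewrite mule_ge0 ?lee_fin//; apply: integral_ge0 => y _; exact: (Xl0 (t, y)).
rewrite integral_M; last 2 first.
- by apply/measurable_EFinP; apply: measurable_funM => //; exact: measurable_funX.
- by move=> p; rewrite lee_fin mulr_ge0 ?sqr_ge0.
apply: eq_integral => t _; rewrite -ge0_integralZr//=; last 3 first.
- exact: (measurableT_comp mXl (measurable_fun_pair (measurable_cst t) (@measurable_id _ _ _))).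
- by move=> y _; exact: (Xl0 (t, y)).
- by rewrite lee_fin.
by apply: eq_integral => y _; rewrite -EFinM /X /q/=; congr (_%:E); ring.
Qed.

Theorem van_trees_inequality :
  (iint (fun t : l.-tuple R => (dlam t * prior t)%:E) *
   iint (fun t : l.-tuple R => (dlam t * prior t)%:E) /
   (iint (fun t : l.-tuple R => (\sum_(j < n) ((dm j t / s j t) ^+ 2 * prior t))%:E) +
    iint (fun t : l.-tuple R =>
      (2^-1 * \sum_(j < n) (dv j t ^+ 2 / s j t ^+ 4 * prior t))%:E) +
    \int[mu]_z (dphi z ^+ 2 / phi i z)%:E) <=
   iint (fun t : l.-tuple R =>
    (iint (fun x : n.-tuple R =>
       ((lamhat [tuple (m j t + s j t * tnth x j)%R | j < n] - lam t) ^+ 2 *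
        \prod_(j < n) normal_pdf 0 1 (tnth x j))%:E) * (prior t)%:E)%E))%E.
Proof. by rewrite iint_Lam iint_F iint_B iint_risk; exact: van_trees_M. Qed.

End van_trees.

(** * Continuous functions on [0, 1] and the sup norm *)

Section sup_norm.
Context {R : realType}.

Lemma supn01_le (f : R -> R) (c : R) :
  (forall x : R, x \in `[0, 1] -> `|f x| <= c) -> supn01 f <= c.
Proof.
move=> fc; apply: ge_sup; last by move=> _ [x /= x01 <-]; exact: fc.
by exists `|f 0|, 0 => //=; rewrite in_itv/= lexx ler01.
Qed.

Lemma C01_bounded (f : R -> R) : C01 f ->
  exists2 c : R, 0 <= c & forall x : R, x \in `[0, 1] -> `|f x| <= c.
Proof.
move=> cf.
have [c1 _ H1] := @EVT_max R f 0 1 ler01 cf.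
have [c2 _ H2] := @EVT_min R f 0 1 ler01 cf.
exists (`|f c1| + `|f c2|) => [|x x01]; first exact: addr_ge0.
have h1 := H1 x x01; have h2 := H2 x x01.
have := ler_norm (f c1); have := ler_norm (- f c2); rewrite normrN => h3 h4.
have := normr_ge0 (f c1); have := normr_ge0 (f c2) => h5 h6.
by rewrite ler_norml; apply/andP; split; lra.
Qed.

Lemma C01_L1 (f : R -> R) : C01 f -> L1_01 f.
Proof.
move=> cf; apply: continuous_compact_integrable => //.
exact: segment_compact.
Qed.

Lemma C01_lin (a b : R) (f1 f2 : R -> R) :
  C01 f1 -> C01 f2 -> C01 (fun x => a * f1 x + b * f2 x).
Proof.
move=> c1 c2 x; apply: cvgD; apply: cvgM.
- exact: cvg_cst.
- exact: c1.
- exact: cvg_cst.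
- exact: c2.
Qed.

End sup_norm.

(** * Parameters as row vectors and as tuples *)

Section row_of_tuple.
Context {R : realType} (l : nat).

Definition row_of (t : l.-tuple R) : 'rV[R]_l := \row_(k < l) tnth t k.

Lemma row_of_tshift (k : 'I_l) (h : R) t :
  row_of (tshift k h t) = row_of t + h *: unitv k.
Proof.
apply/rowP => j; rewrite !mxE tnth_tshift eqxx/= mulrC.
by congr (_ + _ * _).
Qed.

Lemma Phi_row_of (phi : 'I_l -> R -> R) t : Phi phi (row_of t) = prior phi t.
Proof. by apply: eq_bigr => k _; rewrite mxE. Qed.

Lemma continuous_is_derive_tshift (k : 'I_l) (f df : l.-tuple R -> R) :
  (forall t, is_derive (0 : R) 1 (fun h => f (tshift k h t)) (df t)) ->
  forall t, continuous (fun h => f (tshift k h t)).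
Proof.
move=> fdf t x; apply: differentiable_continuous; apply/derivable1_diffP.
by have [] := is_derive_tshift fdf t x.
Qed.

End row_of_tuple.

(** Chain rule along the curve h |-> S h, whose increment is h S' plus [rem]. The error of the
    Fréchet expansion and the value of L at [rem] are each at most (e / 4) |h|, and e / 2 < e gives
    the strict bound. *)
Lemma is_derive_frechet (R : realType) (g : R -> (R -> R) -> R)
  (L : R -> (R -> R) -> (R -> R) -> R) (x : R) (S : R -> R -> R) (S' : R -> R) :
  H2 g L -> x \in `[0, 1] -> (forall h, C01 (S h)) -> C01 S' ->
  (forall eps : R, 0 < eps -> exists delta : R, 0 < delta /\
     forall h : R, h != 0 -> `|h| < delta -> forall z : R, z \in `[0, 1] ->
       `| (S h z - S 0 z - S' z * h) / h | <= eps) ->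
  is_derive (0 : R) 1 (fun h => g x (S h) ^+ 2) (L x (S 0) S').
Proof.
move=> hH2 x01 CS CS' dS; apply/is_derive_quotientP => e e0.
have [Llin [[C LC] Frechet]] := hH2 x (S 0) x01 (CS 0).
have [c c0 S'c] := C01_bounded CS'.
(* The bound [C] need not be positive, whereas C' can be divided by. *)
pose C' := `|C| + 1.
have C'0 : 0 < C' by rewrite ltr_pwDr.
pose e1 := e / (4 * (1 + c)).
have e10 : 0 < e1 by rewrite divr_gt0// mulr_gt0// ltr_pwDl.
have [d1 [d10 H1]] := Frechet e1 e10.
(* The bound 1 makes the increment of S at most (1 + c) |h|, which explains e1; the bound e / (4 C')
   controls L at [rem]. *)
pose e2 := Num.min 1 (e / (4 * C')).
have e20 : 0 < e2 by rewrite lt_min ltr01 divr_gt0// mulr_gt0.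
have [d2 [d20 H2']] := dS e2 e20.
exists (Num.min d2 (d1 / (2 * (1 + c)))) => [|h h0].
  by rewrite lt_min d20/= divr_gt0// mulr_gt0// ltr_pwDl.
rewrite lt_min addr0 => /andP[hd2 hd1].
have ah : 0 < `|h| by rewrite normr_gt0.
pose rem z := S h z - S 0 z - S' z * h.
have remle z : z \in `[0, 1] -> `|rem z| <= e2 * `|h|.
  by move=> z01; rewrite -ler_pdivrMr// -normf_div; exact: H2'.
have incle z : z \in `[0, 1] -> `|S h z - S 0 z| <= (1 + c) * `|h|.
  move=> z01; rewrite (_ : _ - _ = rem z + S' z * h); last by rewrite /rem subrK.
  apply: le_trans (ler_normD _ _) _; rewrite mulrDl lerD//.
    by apply: le_trans (remle _ z01) _; rewrite ler_wpM2r// ge_min lexx.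
  by rewrite normrM ler_wpM2r// S'c.
have CD : C01 (fun z => S h z - S 0 z).
  have := C01_lin (a := 1) (b := -1) (CS h) (CS 0).
  by under eq_fun do rewrite mul1r mulN1r.
have remE : rem = (fun z => 1 * (S h z - S 0 z) + (- h) * S' z).
  by apply/funext => z; rewrite /rem; ring.
have Crem : C01 rem by rewrite remE; exact: C01_lin.
have Lrem : L x (S 0) rem = L x (S 0) (fun z => S h z - S 0 z) - h * L x (S 0) S'.
  by rewrite remE Llin// mul1r mulNr.
have supinc : supn01 (fun z => S h z - S 0 z) <= (1 + c) * `|h| by exact: supn01_le.
have c10 : 0 < 1 + c by rewrite ltr_pwDl.
have F1 : `|g x (S h) ^+ 2 - g x (S 0) ^+ 2 - L x (S 0) (fun z => S h z - S 0 z)|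
    <= e / 4 * `|h|.
  have lt1 : supn01 (fun z => S h z - S 0 z) < d1.
    apply: le_lt_trans supinc _.
    by move: hd1; rewrite ltr_pdivlMr ?mulr_gt0//; nra.
  apply: le_trans (H1 _ (CS h) lt1) _.
  apply: le_trans (ler_wpM2l (ltW e10) supinc) _.
  rewrite (_ : e1 * _ = e / 4 * `|h|)// /e1; field; lra.
have F2 : `|L x (S 0) rem| <= e / 4 * `|h|.
  apply: le_trans (LC _ Crem) _.
  have sup0 : 0 <= supn01 rem.
    apply: (@le_trans _ _ `|rem 0|) => //; apply: ub_le_sup.
      by exists (e2 * `|h|) => _ [z /= z01 <-]; exact: remle.
    by exists 0 => //=; rewrite in_itv/= lexx ler01.
  apply: (@le_trans _ _ (C' * supn01 rem)).
    by rewrite ler_wpM2r// /C'; have := ler_norm C; lra.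
  apply: (@le_trans _ _ (C' * (e2 * `|h|))).
    by rewrite ler_pM2l//; exact: supn01_le.
  rewrite mulrA ler_wpM2r// -ler_pdivlMl// mulrC /e2.
  rewrite ge_min; apply/orP; right.
  by rewrite le_eqVlt; apply/orP; left; apply/eqP; field; lra.
have -> : (g x (S h) ^+ 2 - g x (S 0) ^+ 2) / h - L x (S 0) S' =
  ((g x (S h) ^+ 2 - g x (S 0) ^+ 2 - L x (S 0) (fun z => S h z - S 0 z)) + L x (S 0) rem) / h.
  by rewrite Lrem; field.
rewrite normf_div ltr_pdivrMr//.
apply: le_lt_trans (ler_normD _ _) _.
apply: le_lt_trans (lerD F1 F2) _; nra.
Qed.

(** * Design points and application to the regression model *)

Lemma xpt_itv (R : realType) n (j : 'I_n) : (xpt j : R) \in `[0, 1].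
Proof.
have n0 : (0 < n)%N by apply: leq_ltn_trans (ltn_ord j).
rewrite in_itv/= /xpt divr_ge0//= ler_pdivrMr ?ltr0n// mul1r ler_nat.
exact: ltn_ord.
Qed.

Unset Implicit Arguments.
Theorem theorem6p1 (R : realType) (n l k : nat) (r : R)
  (g : R -> (R -> R) -> R) (L : R -> (R -> R) -> (R -> R) -> R)
  (S : 'rV[R]_l -> R -> R) (S' : 'I_l -> 'rV[R]_l -> R -> R)
  (phi : 'I_l -> R -> R) (lam : 'rV[R]_l -> R) (lamhat : n.-tuple R -> R) :
  (1 <= k)%N -> 0 < r -> H1 g k r -> H2 g L ->
  (* S_theta in C[0,1] *)
  (forall th, C01 (S th)) ->
  (* prior: continuously differentiable bounded probability densities with finite Fisher information *)
  (forall i z, derivable (phi i) z 1) ->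
  (forall i, continuous (derive1 (phi i))) ->
  (forall i, exists M : R, forall z, phi i z <= M) ->
  (forall i z, 0 <= phi i z) ->
  (forall i, (\int[@lebesgue_measure R]_z (phi i z)%:E = 1)%E) ->
  (forall i, (\int[@lebesgue_measure R]_z ((derive1 (phi i) z) ^+ 2 / phi i z)%:E
               < +oo)%E) ->
  (* lambda continuously differentiable *)
  (forall th, differentiable lam th) ->
  (forall i, continuous (fun th => 'D_(unitv i) lam th)) ->
  (forall i th, (fun t => lam (upd th i t) * phi i t) @ +oo --> 0) ->
  (forall i th, (fun t => lam (upd th i t) * phi i t) @ -oo --> 0) ->
  (forall i, (int_Rl (fun th => (`|'D_(unitv i) lam th| * Phi phi th)%:E) < +oo)%E) ->
  (* derivative of theta |-> S_theta in the sup norm *)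
  (forall i th, C01 (S' i th)) ->
  (forall i th (eps : R), 0 < eps -> exists delta : R, 0 < delta /\
     forall h : R, h != 0 -> `|h| < delta -> forall x, x \in `[0, 1] ->
       `| (S (th + h *: unitv i) x - S th x - S' i th x * h) / h | <= eps) ->
  (* lamhat: a (Borel) square integrable estimator *)
  measurable_fun setT lamhat ->
  (Etilde g S phi (fun y _ => (lamhat y ^+ 2)%R) < +oo)%E ->
  forall i : 'I_l,
    let Lam := int_Rl (fun th => ('D_(unitv i) lam th * Phi phi th)%:E) in
    let F := int_Rl (fun th =>
      (\sum_(j < n) (S' i th (xpt j) / sig g S j th) ^+ 2 * Phi phi th)%:E) in
    let B := int_Rl (fun th =>
      (2^-1 * \sum_(j < n) (L (xpt j) (S th) (S' i th) ^+ 2 / sig g S j th ^+ 4)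
        * Phi phi th)%:E) in
    let I := (\int[@lebesgue_measure R]_z ((derive1 (phi i) z) ^+ 2 / phi i z)%:E)%E in
    (Lam * Lam / (F + B + I) <= Etilde g S phi (fun y th => ((lamhat y - lam th) ^+ 2)%R))%E.
Proof.
move=> k1 r0 hH1 hH2 CS dphi cdphi _ phi0 phi1 phiI dlam cdlam _ _ ilam CS' dS mlamhat _ i.
(* [H1] grants positivity for functions in L1[0, 1], so the continuous S is placed there. *)
have s0 (j : 'I_n) (t : l.-tuple R) : 0 < g (xpt j : R) (S (row_of t)).
  by apply: hH1.1; [exact: xpt_itv|exact: C01_L1].
(* Every direction k' is treated: direction i supplies the score, and all directions together supply
   the separate continuity behind measurability. *)
have is_derive_m k' (j : 'I_n) t : is_derive (0 : R) 1
    (fun h => S (row_of (tshift k' h t)) (xpt j)) (S' k' (row_of t) (xpt j)).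
  apply/is_derive_quotientP => e e0.
  (* Halving e turns the weak inequality of the hypothesis into the strict one required. *)
  have e20 : 0 < e / 2 by rewrite divr_gt0.
  have [d [d0 dH]] := dS k' (row_of t) (e / 2) e20.
  exists d => // h h0 hd; rewrite addr0 tshift0 row_of_tshift.
  apply: (@le_lt_trans _ _ (e / 2)); last by lra.
  have := dH h h0 hd (xpt j) (xpt_itv _ j).
  by congr (`|_| <= _); field.
have is_derive_v k' (j : 'I_n) t : is_derive (0 : R) 1
    (fun h => g (xpt j) (S (row_of (tshift k' h t))) ^+ 2)
    (L (xpt j) (S (row_of t)) (S' k' (row_of t))).
  have := @is_derive_frechet R g L (xpt j) (fun h => S (row_of (tshift k' h t)))
    (S' k' (row_of t)) hH2 (xpt_itv _ j) (fun=> CS _) (CS' _ _).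
  rewrite tshift0; apply => e e0.
  have [d [d0 dH]] := dS k' (row_of t) e e0; exists d; split => // h h0 hd z z01.
  by rewrite row_of_tshift; exact: dH.
have is_derive_lam k' t : is_derive (0 : R) 1
    (fun h => lam (row_of (tshift k' h t))) ('D_(unitv k') lam (row_of t)).
  apply/is_derive_quotientP => e e0.
  have : derivable lam (row_of t) (unitv k') by exact: diff_derivable.
  move/cvgrPdist_lt => /(_ _ e0)/nbhs_ballP[d /= d0 dH].
  exists d => // h h0 hd; rewrite addr0 tshift0 distrC.
  have := dH h; rewrite /ball/= sub0r normrN => /(_ hd h0).
  by rewrite row_of_tshift (addrC (row_of t)) [_ / h]mulrC.
have cphi k' : continuous (phi k').
  by move=> z; apply: differentiable_continuous; apply/derivable1_diffP; exact: dphi.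
have cm (j : 'I_n) k' (t : l.-tuple R) :
    continuous (fun h => S (row_of (tshift k' h t)) (xpt j)).
  exact: (continuous_is_derive_tshift (f := fun t => S (row_of t) (xpt j)) (is_derive_m k' j)).
have cv (j : 'I_n) k' (t : l.-tuple R) :
    continuous (fun h => g (xpt j) (S (row_of (tshift k' h t))) ^+ 2).
  exact: (continuous_is_derive_tshift (f := fun t => g (xpt j) (S (row_of t)) ^+ 2)
    (is_derive_v k' j)).
have clam k' (t : l.-tuple R) : continuous (fun h => lam (row_of (tshift k' h t))).
  exact: (continuous_is_derive_tshift (f := fun t => lam (row_of t)) (is_derive_lam k')).
have priorE : prior phi = (fun t : l.-tuple R => Phi phi (row_of t)).
  by apply/funext => t; rewrite Phi_row_of.
have dphiE (z : R) : is_derive z 1 (phi i) (derive1 (phi i) z).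
  by split; [exact: dphi|rewrite derive1E].
(* The variance g^2 has derivative [L] applied to S', so dv^2 / s^4 becomes the integrand of [B]. *)
have := @van_trees_inequality R n l i
  (fun j t => S (row_of t) (xpt j)) (fun j t => g (xpt j) (S (row_of t)))
  (fun j t => S' i (row_of t) (xpt j))
  (fun j t => L (xpt j) (S (row_of t)) (S' i (row_of t)))
  (fun t => lam (row_of t)) (fun t => 'D_(unitv i) lam (row_of t))
  phi (derive1 (phi i)) lamhat s0
  cm cv clam (is_derive_m i) (is_derive_v i) (is_derive_lam i)
  (fun k' => continuous_measurable_fun (cphi k'))
  (continuous_measurable_fun (cdphi i))
  phi0 phi1 dphiE mlamhat (phiI i).
by rewrite priorE => /(_ (ilam i)).
Qed.
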